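(* Let $n$ be a sufficiently large positive integer, and let $t$, $\gamma$, $\delta$ and $C$ be as in the context. There exist signs $\varepsilon_k\in\{-1,1\}$ for $k\in C$, defining the cosine polynomial $c(\theta)=\sum_{k\in C}\varepsilon_k\cos(k\theta)$, and a suitable and well-separated collection $\mathcal{I}$ of pairwise disjoint intervals in $\mathbb{R}/2\pi\mathbb{Z}$, such that $|c(\theta)|\ge \delta\sqrt{n}$ for all $\theta\notin\bigcup_{I\in\mathcal{I}}I$, and $|c(\theta)|\le\sqrt{n}$ for all $\theta\in\mathbb{R}/2\pi\mathbb{Z}$.
   Context: Standing setup: $t$ is an odd integer such that $\gamma := (2^{t+11}+2^t-1)/n$ satisfies $2^{-43}<\gamma\le 2^{-40}$; $\delta := 2^{-8}\gamma^{7/2}$; $C := 2C'$ where $C' := \{2^{t+10},\dots,2^{t+10}+2^t-1\}\cup\{2^{t+11},\dots,2^{t+11}+2^t-1\}$ (so $C$ consists of $2^{t+1}$ even integers). A collection $\mathcal{I}$ of pairwise disjoint intervals in $\mathbb{R}/2\pi\mathbb{Z}$ is suitable if (a) the endpoints of each interval in $\mathcal{I}$ lie in $\frac{\pi}{n}\mathbb{Z}$; (b) $\mathcal{I}$ is invariant under the maps $\theta\mapsto\pi+\theta$ and $\theta\mapsto\pi-\theta$; (c) $|\mathcal{I}|=4N$ for some integer $N\le\gamma n$. A suitable collection is well-separated if moreover (d) each $I\in\mathcal{I}$ has length $|I|\le 6\pi/n$; (e) $d(I,J)\ge\pi/n$ for all distinct $I,J\in\mathcal{I}$, where $d(I,J)=\inf\{d(\theta,\theta'):\theta\in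 I,\theta'\in J\}$ and $d(\theta,\theta')$ is the distance mod $2\pi$; (f) $\bigcup_{I\in\mathcal{I}}I$ is disjoint from $(\pi/2)\mathbb{Z}+[-100\pi/n,100\pi/n]$. *)

(* Defs.v *)
From Stdlib Require Import Reals Lra Lia ZArith List.
Open Scope R_scope.

Definition gam (n t : nat) : R := (2 ^ (t + 11) + 2 ^ t - 1) / INR n.

Definition del (n t : nat) : R := Rpower (gam n t) (7 / 2) / 2 ^ 8.

Definition Cset (t : nat) : list nat :=
  map (fun m => (2 * m)%nat) (seq (2 ^ (t + 10)) (2 ^ t) ++ seq (2 ^ (t + 11)) (2 ^ t)).

Definition cpoly (t : nat) (eps : nat -> R) (theta : R) : R :=
  fold_right (fun k acc => eps k * cos (INR k * theta) + acc) 0 (Cset t).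

(* An interval of R/2piZ with endpoints in (pi/n)Z, encoded by an integer pair
   (a,b) with a < b < a + 2n: the closed arc [a pi/n, b pi/n] mod 2 pi,
   seen as a 2pi-periodic subset of R. *)
Definition arc (n : nat) (I : Z * Z) (theta : R) : Prop :=
  exists k : Z, IZR (fst I) * PI / INR n <= theta + 2 * PI * IZR k <= IZR (snd I) * PI / INR n.

Definition proper_arc (n : nat) (I : Z * Z) : Prop :=
  (fst I < snd I)%Z /\ (snd I - fst I < 2 * Z.of_nat n)%Z.

Definition arc_dist_ge (n : nat) (I J : Z * Z) (r : R) : Prop :=
  forall theta theta', arc n I theta -> arc n J theta' ->
    forall k : Z, r <= Rabs (theta - theta' - 2 * PI * IZR k).

(* A collection of pairwise disjoint intervals, given as a list whose entries
   (at distinct positions) are pairwise disjoint arcs; |collection| = length. *)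
Definition suitable (n : nat) (g : R) (l : list (Z * Z)) : Prop :=
  (forall I, In I l -> proper_arc n I) /\
  (forall i j : nat, (i < j < length l)%nat -> forall theta,
      ~ (arc n (nth i l (0%Z, 0%Z)) theta /\ arc n (nth j l (0%Z, 0%Z)) theta)) /\
  (forall I, In I l -> exists J, In J l /\
      forall theta, arc n J theta <-> arc n I (theta - PI)) /\
  (forall I, In I l -> exists J, In J l /\
      forall theta, arc n J theta <-> arc n I (PI - theta)) /\
  (exists N : nat, length l = (4 * N)%nat /\ INR N <= g * INR n).

Definition well_separated (n : nat) (g : R) (l : list (Z * Z)) : Prop :=
  suitable n g l /\
  (forall I, In I l -> (snd I - fst I <= 6)%Z) /\
  (forall i j : nat, (i < length l)%nat -> (j < length l)%nat -> i <> j ->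
      arc_dist_ge n (nth i l (0%Z, 0%Z)) (nth j l (0%Z, 0%Z)) (PI / INR n)) /\
  (forall I, In I l -> forall theta, arc n I theta ->
      forall (m : Z) (y : R), Rabs y <= 100 * PI / INR n -> theta <> IZR m * (PI / 2) + y).

(* Main.v *)
Require Import Defs.
From Stdlib Require Import Reals ZArith List Lra Lia Psatz Classical.
Open Scope R_scope.

(* Take the signs from the Rudin-Shapiro pair, so that, with [A = 2^(t+10)] and [z = e^(2 i theta)],
   [c(theta) = Re (z^A P_t(z) + z^(2A) Q_t(z))] and [|P_t|^2 + |Q_t|^2 = 2^(t+1)].
   The recursion also gives Bernstein's inequality for [(P_t, Q_t)], so on the scale [1/A] the
   function is close to [a cos(Ax + alpha) + b cos(2Ax + beta)] with [a^2 + b^2 = 2^(t+1)]; hence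
   [c] and its first three derivatives are never simultaneously small.  Cut the circle into cells
   of length [pi/n] and call a cell bad if [|c| < delta sqrt n] somewhere on it.  Seven consecutive
   bad cells would give four separated points with [|c|] tiny, and then, comparing [c] with its
   cubic interpolant, a point where [c] and its first three derivatives are all small.  So
   the maximal runs of bad cells have length at most [6 pi/n]; they are the intervals.  There are
   at most [gamma n] of them in [(0, pi/2)]: for [eta] slightly below [delta sqrt n], [c^2 - eta^2]
   is a polynomial in [cos(2 theta)] of degree [2 gamma n] with two zeros per run.  Since [t] is odd, [c] equals [2^((t+1)/2)] at the multiples of [pi/2], which keeps
   the runs away from these points and makes the orbits of the symmetries have size four. *)

(** * Rudin-Shapiro polynomials *)

(* [csum j a [e0; e1; ...] x] and [ssum j a [e0; e1; ...] x] are the real and imaginary parts of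
   [sum_i e_i (a + i)^j e^(i (a + i) x)]. *)
Fixpoint csum (j : nat) (a : R) (L : list R) (x : R) : R :=
  match L with
  | nil => 0
  | e :: L' => e * a ^ j * cos (a * x) + csum j (a + 1) L' x
  end.

Fixpoint ssum (j : nat) (a : R) (L : list R) (x : R) : R :=
  match L with
  | nil => 0
  | e :: L' => e * a ^ j * sin (a * x) + ssum j (a + 1) L' x
  end.

(** The shift comes first in [INR (length L1) + a] so that [csum_shift] applies to the second
    block. *)
Lemma csum_app j L1 L2 a x :
  csum j a (L1 ++ L2) x = csum j a L1 x + csum j (INR (length L1) + a) L2 x.
Proof.
  revert a; induction L1 as [|e L1 IH]; intros a.
  - simpl; rewrite !Rplus_0_l; reflexivity.
  - cbn [app length csum]; rewrite IH, S_INR.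
    replace (INR (length L1) + (a + 1)) with (INR (length L1) + 1 + a) by ring. ring.
Qed.

Lemma ssum_app j L1 L2 a x :
  ssum j a (L1 ++ L2) x = ssum j a L1 x + ssum j (INR (length L1) + a) L2 x.
Proof.
  revert a; induction L1 as [|e L1 IH]; intros a.
  - simpl; rewrite !Rplus_0_l; reflexivity.
  - cbn [app length ssum]; rewrite IH, S_INR.
    replace (INR (length L1) + (a + 1)) with (INR (length L1) + 1 + a) by ring. ring.
Qed.

Lemma csum_opp j L a x : csum j a (map Ropp L) x = - csum j a L x.
Proof.
  revert a; induction L as [|e L IH]; intros a; simpl; [ring|rewrite IH; ring].
Qed.

Lemma ssum_opp j L a x : ssum j a (map Ropp L) x = - ssum j a L x.
Proof.
  revert a; induction L as [|e L IH]; intros a; simpl; [ring|rewrite IH; ring].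
Qed.

Lemma derivable_pt_lim_linear a x : derivable_pt_lim (fun y => a * y) x a.
Proof.
  pose proof (derivable_pt_lim_scal (fun y => y) a x 1 (derivable_pt_lim_id x)) as H.
  rewrite Rmult_1_r in H; exact H.
Qed.

Lemma csum_deriv j L a x : derivable_pt_lim (csum j a L) x (- ssum (S j) a L x).
Proof.
  revert a; induction L as [|e L IH]; intros a.
  - simpl; rewrite Ropp_0; apply derivable_pt_lim_const.
  - cbn [csum ssum].
    replace (- (e * a ^ S j * sin (a * x) + ssum (S j) (a + 1) L x))
      with (e * a ^ j * (- sin (a * x) * a) + - ssum (S j) (a + 1) L x) by (simpl; ring).
    apply (derivable_pt_lim_plus (fun y => e * a ^ j * cos (a * y))); [|apply IH].
    apply (derivable_pt_lim_scal (fun y => cos (a * y))).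
    apply (derivable_pt_lim_comp (fun y => a * y) cos); [|apply derivable_pt_lim_cos].
    apply derivable_pt_lim_linear.
Qed.

Lemma ssum_deriv j L a x : derivable_pt_lim (ssum j a L) x (csum (S j) a L x).
Proof.
  revert a; induction L as [|e L IH]; intros a.
  - simpl; apply derivable_pt_lim_const.
  - cbn [csum ssum].
    replace (e * a ^ S j * cos (a * x)) with (e * a ^ j * (cos (a * x) * a)) by (simpl; ring).
    apply (derivable_pt_lim_plus (fun y => e * a ^ j * sin (a * y))); [|apply IH].
    apply (derivable_pt_lim_scal (fun y => sin (a * y))).
    apply (derivable_pt_lim_comp (fun y => a * y) sin); [|apply derivable_pt_lim_sin].
    apply derivable_pt_lim_linear.
Qed.

(* With [D = z d/dz] and [z = e^(ix)], multiplication by [z^b] turns [D^j] into [(b + D)^j]. *)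
Definition shifted (j : nat) (b : R) (F : nat -> R) : R :=
  match j with
  | 0%nat => F 0%nat
  | 1%nat => b * F 0%nat + F 1%nat
  | 2%nat => b ^ 2 * F 0%nat + 2 * b * F 1%nat + F 2%nat
  | _ => b ^ 3 * F 0%nat + 3 * b ^ 2 * F 1%nat + 3 * b * F 2%nat + F 3%nat
  end.

(** Term by term, this is the addition formula for the angle [(b + a) x] together with the binomial
    expansion of [(b + a)^j]. *)
Lemma csum_shift j b L a x :
  (j <= 3)%nat ->
  csum j (b + a) L x =
    cos (b * x) * shifted j b (fun k => csum k a L x)
    - sin (b * x) * shifted j b (fun k => ssum k a L x) /\
  ssum j (b + a) L x =
    sin (b * x) * shifted j b (fun k => csum k a L x)
    + cos (b * x) * shifted j b (fun k => ssum k a L x).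
Proof.
  intros Hj; revert a; induction L as [|e L IH]; intros a;
    (destruct j as [|[|[|[|j]]]]; [| | | |lia]).
  1-4: split; simpl; ring.
  all: destruct (IH (a + 1)) as [H1 H2]; split; cbn [csum ssum];
    rewrite (Rplus_assoc b a 1), ?H1, ?H2, Rmult_plus_distr_r, ?cos_plus, ?sin_plus;
    cbn [csum ssum shifted]; ring.
Qed.

Fixpoint rudin_shapiro (t : nat) : list R * list R :=
  match t with
  | O => (1 :: nil, 1 :: nil)
  | S t' => let '(P, Q) := rudin_shapiro t' in (P ++ Q, P ++ map Ropp Q)
  end.

Definition RSP (t : nat) : list R := fst (rudin_shapiro t).
Definition RSQ (t : nat) : list R := snd (rudin_shapiro t).

Lemma RSP_S t : RSP (S t) = RSP t ++ RSQ t.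
Proof. unfold RSP, RSQ; simpl; destruct (rudin_shapiro t); reflexivity. Qed.

Lemma RSQ_S t : RSQ (S t) = RSP t ++ map Ropp (RSQ t).
Proof. unfold RSP, RSQ; simpl; destruct (rudin_shapiro t); reflexivity. Qed.

Lemma RS_length t : length (RSP t) = (2 ^ t)%nat /\ length (RSQ t) = (2 ^ t)%nat.
Proof.
  induction t as [|t [H1 H2]]; [split; reflexivity|].
  rewrite RSP_S, RSQ_S, !length_app, length_map, H1, H2; simpl; lia.
Qed.

Lemma RS_signs t :
  Forall (fun e => e = 1 \/ e = -1) (RSP t) /\ Forall (fun e => e = 1 \/ e = -1) (RSQ t).
Proof.
  induction t as [|t [H1 H2]].
  - split; repeat constructor; left; reflexivity.
  - rewrite RSP_S, RSQ_S; split; apply Forall_app; split; auto.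
    apply Forall_map; eapply Forall_impl; [|exact H2].
    intros e [->| ->]; [right|left]; lra.
Qed.

Lemma INR_pow2 t : INR (2 ^ t) = 2 ^ t.
Proof. rewrite pow_INR; reflexivity. Qed.

(** A Euclidean ball of C^2, in squared form to avoid square roots; the coordinates hold the real
    and imaginary parts of two complex numbers. *)
Definition ball4 (a b c d r : R) : Prop := a ^ 2 + b ^ 2 + c ^ 2 + d ^ 2 <= r ^ 2.

(** Minkowski's inequality; the cross term is bounded by Cauchy-Schwarz. *)
Lemma ball4_add a b c d a' b' c' d' r s :
  0 <= r -> 0 <= s -> ball4 a b c d r -> ball4 a' b' c' d' s ->
  ball4 (a + a') (b + b') (c + c') (d + d') (r + s).
Proof.
  unfold ball4; intros Hr Hs H1 H2.
  assert (H : a * a' + b * b' + c * c' + d * d' <= r * s).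
  { apply Rsqr_incr_0_var; [|nra].
    unfold Rsqr.
    apply Rle_trans with ((a ^ 2 + b ^ 2 + c ^ 2 + d ^ 2) * (a' ^ 2 + b' ^ 2 + c' ^ 2 + d' ^ 2)).
    (* Lagrange's identity: these six squares sum to the defect in Cauchy-Schwarz. *)
    - assert (0 <= (a*b'-b*a')^2 + (a*c'-c*a')^2 + (a*d'-d*a')^2 + (b*c'-c*b')^2
                   + (b*d'-d*b')^2 + (c*d'-d*c')^2).
      { repeat apply Rplus_le_le_0_compat; apply pow2_ge_0. }
      lra.
    - replace (r * s * (r * s)) with (r ^ 2 * s ^ 2) by ring.
      apply Rmult_le_compat; auto; repeat apply Rplus_le_le_0_compat; apply pow2_ge_0. }
  lra.
Qed.

Lemma ball4_scale a b c d r k :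
  ball4 a b c d r -> ball4 (k * a) (k * b) (k * c) (k * d) (k * r).
Proof.
  unfold ball4; intros H. pose proof (pow2_ge_0 k). nra.
Qed.

(** In [P_t + z^N Q_t] and [P_t - z^N Q_t] only [Q_t] is shifted, so its lower moments enter without
    those of [P_t]. *)
Lemma ball4_drop a b c d r : ball4 a b c d r -> ball4 0 0 c d r.
Proof. unfold ball4; intros H; pose proof (pow2_ge_0 a); pose proof (pow2_ge_0 b); lra. Qed.

(** With [w = u + i v] of modulus one, this is the parallelogram law [|X + w Y|^2 + |X - w Y|^2 = 2
    (|X|^2 + |Y|^2)]. *)
Lemma parallelogram_rot u v a b c d :
  u ^ 2 + v ^ 2 = 1 ->
  (a + (u * c - v * d)) ^ 2 + (b + (v * c + u * d)) ^ 2
  + (a - (u * c - v * d)) ^ 2 + (b - (v * c + u * d)) ^ 2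
  = 2 * (a ^ 2 + b ^ 2 + c ^ 2 + d ^ 2).
Proof.
  intros H.
  replace (2 * (a ^ 2 + b ^ 2 + c ^ 2 + d ^ 2))
    with (2 * (a ^ 2 + b ^ 2 + (u ^ 2 + v ^ 2) * (c ^ 2 + d ^ 2))) by (rewrite H; ring).
  ring.
Qed.

Definition RSball (k t : nat) (x r : R) : Prop :=
  ball4 (csum k 0 (RSP t) x) (ssum k 0 (RSP t) x) (csum k 0 (RSQ t) x) (ssum k 0 (RSQ t) x) r.

(** Here [c + i d] is the order-[k] moment of [z^(2^t) Q_t] with the unimodular factor [z^(2^t)]
    taken out. *)
Lemma RS_moment_S k t x c d :
  (csum k (2 ^ t + 0) (RSQ t) x = cos (2 ^ t * x) * c - sin (2 ^ t * x) * d /\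
   ssum k (2 ^ t + 0) (RSQ t) x = sin (2 ^ t * x) * c + cos (2 ^ t * x) * d) ->
  csum k 0 (RSP (S t)) x ^ 2 + ssum k 0 (RSP (S t)) x ^ 2
  + csum k 0 (RSQ (S t)) x ^ 2 + ssum k 0 (RSQ (S t)) x ^ 2
  = 2 * (csum k 0 (RSP t) x ^ 2 + ssum k 0 (RSP t) x ^ 2 + c ^ 2 + d ^ 2).
Proof.
  intros [H1 H2].
  rewrite RSP_S, RSQ_S, !csum_app, !ssum_app, csum_opp, ssum_opp.
  rewrite (proj1 (RS_length t)), INR_pow2, H1, H2.
  apply parallelogram_rot.
  pose proof (sin2_cos2 (2 ^ t * x)) as H; unfold Rsqr in H; lra.
Qed.

Lemma RS_norm t x :
  csum 0 0 (RSP t) x ^ 2 + ssum 0 0 (RSP t) x ^ 2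
  + csum 0 0 (RSQ t) x ^ 2 + ssum 0 0 (RSQ t) x ^ 2 = 2 ^ S t.
Proof.
  induction t as [|t IH].
  - simpl; rewrite Rmult_0_l, cos_0, sin_0; ring.
  - rewrite (RS_moment_S _ _ _ _ _ (csum_shift 0 _ _ _ _ ltac:(lia))).
    cbn [shifted]; rewrite IH; simpl; ring.
Qed.

(** By [RS_norm], the norm of [(P_t, Q_t)] at every point of the unit circle; it serves as the unit
    for all later sizes. *)
Definition amp (t : nat) : R := sqrt (2 ^ S t).

Lemma amp_sq t : amp t ^ 2 = 2 ^ S t.
Proof. unfold amp; rewrite pow2_sqrt; [reflexivity|apply pow_le; lra]. Qed.

Lemma amp_pos t : 0 < amp t.
Proof. apply sqrt_lt_R0, pow_lt; lra. Qed.

(** The factor 2 of the parallelogram law is absorbed by [amp (S t)], so [r] does not change. *)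
Lemma RSball_S k t x c d r :
  (csum k (2 ^ t + 0) (RSQ t) x = cos (2 ^ t * x) * c - sin (2 ^ t * x) * d /\
   ssum k (2 ^ t + 0) (RSQ t) x = sin (2 ^ t * x) * c + cos (2 ^ t * x) * d) ->
  ball4 (csum k 0 (RSP t) x) (ssum k 0 (RSP t) x) c d (r * amp t) ->
  RSball k (S t) x (r * amp (S t)).
Proof.
  unfold RSball, ball4; intros H1 H2.
  rewrite (RS_moment_S _ _ _ _ _ H1), Rpow_mult_distr, amp_sq.
  rewrite Rpow_mult_distr, amp_sq in H2.
  change (2 ^ S (S t)) with (2 * 2 ^ S t). lra.
Qed.

(* Bernstein's inequality for the pair [(P_t, Q_t)], read off the recursion. *)
Lemma RS_bernstein t x :
  RSball 0 t x (amp t) /\ RSball 1 t x (2 ^ t * amp t) /\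
  RSball 2 t x ((2 ^ t) ^ 2 * amp t) /\ RSball 3 t x ((2 ^ t) ^ 3 * amp t).
Proof.
  assert (H0 : forall t, RSball 0 t x (amp t)).
  { intros s; unfold RSball, ball4; rewrite RS_norm, amp_sq; apply Rle_refl. }
  split; [apply H0|].
  induction t as [|t (H1 & H2 & H3)].
  - unfold RSball, ball4; repeat split; simpl; rewrite !Rmult_0_l;
      pose proof (Rle_0_sqr (amp 0)); unfold Rsqr in *; lra.
  - pose proof (amp_pos t) as HR.
    assert (HN : 0 < 2 ^ t) by (apply pow_lt; lra).
    set (N := 2 ^ t) in *.
    assert (HNR : 0 <= N * amp t) by nra.
    assert (HN2 : 0 <= N ^ 2 * amp t) by (apply Rmult_le_pos; [apply pow_le|]; lra).
    assert (HN3 : 0 <= N ^ 3 * amp t) by (apply Rmult_le_pos; [apply pow_le|]; lra).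
    pose proof (ball4_drop _ _ _ _ _ (H0 t)) as K0.
    pose proof (ball4_drop _ _ _ _ _ H1) as K1.
    pose proof (ball4_drop _ _ _ _ _ H2) as K2.
    unfold RSball in H1, H2, H3.
    change (2 ^ S t) with (2 * N).
    split; [|split].
    (* In order [j] the shift turns [D^j] into [(N + D)^j] on [Q_t], and Minkowski's inequality adds
       the terms up to [sum_i binom(j, i) N^(j-i) N^i = (2 N)^j]. *)
    + eapply RSball_S; [apply csum_shift; lia|]; cbn [shifted]; fold N.
      pose proof (ball4_add _ _ _ _ _ _ _ _ _ _ HNR HNR
                    (ball4_scale _ _ _ _ _ N K0) H1) as H.
      unfold ball4 in *.
      match goal with H : ?l <= ?r |- ?l' <= ?r' =>
        replace l' with l by ring; replace r' with r by ring; exact H end.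
    + eapply RSball_S; [apply csum_shift; lia|]; cbn [shifted]; fold N.
      assert (HA : 0 <= 2 * N * (N * amp t)) by nra.
      assert (HB : 0 <= N ^ 2 * amp t + 2 * N * (N * amp t)) by lra.
      pose proof (ball4_add _ _ _ _ _ _ _ _ _ _ HB HN2
        (ball4_add _ _ _ _ _ _ _ _ _ _ HN2 HA
           (ball4_scale _ _ _ _ _ (N ^ 2) K0) (ball4_scale _ _ _ _ _ (2 * N) K1)) H2) as H.
      unfold ball4 in *.
      match goal with H : ?l <= ?r |- ?l' <= ?r' =>
        replace l' with l by ring; replace r' with r by ring; exact H end.
    + eapply RSball_S; [apply csum_shift; lia|]; cbn [shifted]; fold N.
      assert (HA : 0 <= 3 * N ^ 2 * (N * amp t)) by (simpl in *; nra).
      assert (HA' : 0 <= 3 * N * (N ^ 2 * amp t)) by (simpl in *; nra).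
      assert (HB : 0 <= N ^ 3 * amp t + 3 * N ^ 2 * (N * amp t)) by lra.
      assert (HB' : 0 <= N ^ 3 * amp t + 3 * N ^ 2 * (N * amp t) + 3 * N * (N ^ 2 * amp t)) by lra.
      pose proof (ball4_add _ _ _ _ _ _ _ _ _ _ HB' HN3
       (ball4_add _ _ _ _ _ _ _ _ _ _ HB HA'
        (ball4_add _ _ _ _ _ _ _ _ _ _ HN3 HA
           (ball4_scale _ _ _ _ _ (N ^ 3) K0) (ball4_scale _ _ _ _ _ (3 * N ^ 2) K1))
          (ball4_scale _ _ _ _ _ (3 * N) K2)) H3) as H.
      unfold ball4 in *.
      match goal with H : ?l <= ?r |- ?l' <= ?r' =>
        replace l' with l by ring; replace r' with r by ring; exact H end.
Qed.

(** * Local behaviour *)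

(* For [j <= 3], the [j]-th derivative of [Re (e^(iAx) P_t(e^(ix)) + e^(2iAx) Q_t(e^(ix)))] with
   [A = 2^(t+10)]; the paper's [c(theta)] is [RSF 0 t (2 theta)]. *)
Definition RSF (j t : nat) (x : R) : R :=
  match j with
  | 0%nat => csum 0 (2 ^ (t + 10)) (RSP t) x + csum 0 (2 ^ (t + 11)) (RSQ t) x
  | 1%nat => - (ssum 1 (2 ^ (t + 10)) (RSP t) x + ssum 1 (2 ^ (t + 11)) (RSQ t) x)
  | 2%nat => - (csum 2 (2 ^ (t + 10)) (RSP t) x + csum 2 (2 ^ (t + 11)) (RSQ t) x)
  | _ => ssum 3 (2 ^ (t + 10)) (RSP t) x + ssum 3 (2 ^ (t + 11)) (RSQ t) x
  end.

Lemma RSF_deriv j t x : (j < 3)%nat -> derivable_pt_lim (RSF j t) x (RSF (S j) t x).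
Proof.
  intros Hj; destruct j as [|[|[|j]]]; [| | |lia]; cbn [RSF].
  - rewrite Ropp_plus_distr.
    apply (derivable_pt_lim_plus (csum 0 _ _) (csum 0 _ _)); apply csum_deriv.
  - apply (derivable_pt_lim_opp (fun y => _ + _)).
    apply (derivable_pt_lim_plus (ssum 1 _ _) (ssum 1 _ _)); apply ssum_deriv.
  - set (p := ssum 3 _ (RSP t) x); set (q := ssum 3 _ (RSQ t) x).
    replace (p + q) with (- (- p + - q)) by ring.
    apply (derivable_pt_lim_opp (fun y => _ + _)).
    apply (derivable_pt_lim_plus (csum 2 _ _) (csum 2 _ _)); apply csum_deriv.
Qed.

Lemma rot_sq u v X Y :
  u ^ 2 + v ^ 2 = 1 -> (u * X - v * Y) ^ 2 + (v * X + u * Y) ^ 2 = X ^ 2 + Y ^ 2.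
Proof.
  intros H. replace (X ^ 2 + Y ^ 2) with ((u ^ 2 + v ^ 2) * (X ^ 2 + Y ^ 2)) by (rewrite H; ring).
  ring.
Qed.

Lemma rot_le u v X Y r :
  0 <= r -> u ^ 2 + v ^ 2 = 1 -> X ^ 2 + Y ^ 2 <= r ^ 2 ->
  Rabs (u * X - v * Y) <= r /\ Rabs (v * X + u * Y) <= r.
Proof.
  intros Hr Huv H. pose proof (rot_sq u v X Y Huv) as E.
  pose proof (pow2_ge_0 (u * X - v * Y)); pose proof (pow2_ge_0 (v * X + u * Y)).
  split; rewrite <- (Rabs_right r) by lra; apply Rsqr_le_abs_0;
    unfold Rsqr; simpl in *; lra.
Qed.

Lemma cos2_sin2 y : cos y ^ 2 + sin y ^ 2 = 1.
Proof. pose proof (sin2_cos2 y) as H; unfold Rsqr in H; lra. Qed.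

Lemma Rabs_le_bounds a b : Rabs a <= b -> - b <= a <= b.
Proof. intros H; pose proof (Rle_abs a); pose proof (Rle_abs (- a)); rewrite Rabs_Ropp in *; lra. Qed.

(* On the scale [1/A] the function is [Re(p e^(iAx) + q e^(2iAx))] with [p, q] almost constant
   and [|p|^2 + |q|^2 = amp^2]. *)
Lemma RSF_jet t x :
  exists p0 p1 q0 q1 : R,
    let A := 2 ^ (t + 10) in
    p0 ^ 2 + p1 ^ 2 + q0 ^ 2 + q1 ^ 2 = amp t ^ 2 /\
    RSF 0 t x = p0 + q0 /\
    Rabs (RSF 1 t x + A * (p1 + 2 * q1)) <= / 100 * (A * amp t) /\
    Rabs (RSF 2 t x + A ^ 2 * (p0 + 4 * q0)) <= / 100 * (A ^ 2 * amp t) /\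
    Rabs (RSF 3 t x - A ^ 3 * (p1 + 8 * q1)) <= / 50 * (A ^ 3 * amp t).
Proof.
  destruct (RS_bernstein t x) as (_ & B1 & B2 & B3).
  pose proof (RS_norm t x) as B0. rewrite <- amp_sq in B0.
  pose proof (amp_pos t) as HR.
  unfold RSball, ball4 in *.
  assert (HN : 0 < 2 ^ t) by (apply pow_lt; lra).
  cbn [RSF].
  (* By Bernstein, a derivative falling on [P_t] or [Q_t] rather than on its carrier gains a factor
     1024. The error terms of first order in [N / A] have total weight 2, 6 and 15 in the three
     derivatives, hence the bounds 1/100, 1/100 and 1/50. *)
  assert (EA : 2 ^ (t + 10) = 1024 * 2 ^ t) by (rewrite pow_add; simpl; ring).
  assert (EB : 2 ^ (t + 11) = 2 * 2 ^ (t + 10)) by (rewrite !pow_add; simpl; ring).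
  rewrite EB. clear EB. set (A := 2 ^ (t + 10)) in *. set (N := 2 ^ t) in *.
  set (Rt := amp t) in *.
  pose proof (cos2_sin2 (A * x)) as Hu. pose proof (cos2_sin2 (2 * A * x)) as Hw.
  pose proof (csum_shift 0 A (RSP t) 0 x ltac:(lia)) as [S0 _].
  pose proof (csum_shift 0 (2 * A) (RSQ t) 0 x ltac:(lia)) as [T0 _].
  pose proof (csum_shift 1 A (RSP t) 0 x ltac:(lia)) as [_ S1].
  pose proof (csum_shift 1 (2 * A) (RSQ t) 0 x ltac:(lia)) as [_ T1].
  pose proof (csum_shift 2 A (RSP t) 0 x ltac:(lia)) as [S2 _].
  pose proof (csum_shift 2 (2 * A) (RSQ t) 0 x ltac:(lia)) as [T2 _].
  pose proof (csum_shift 3 A (RSP t) 0 x ltac:(lia)) as [_ S3].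
  pose proof (csum_shift 3 (2 * A) (RSQ t) 0 x ltac:(lia)) as [_ T3].
  cbn [shifted] in *. rewrite !Rplus_0_r in S0, T0, S1, T1, S2, T2, S3, T3.
  rewrite S0, T0, S1, T1, S2, T2, S3, T3; clear S0 T0 S1 T1 S2 T2 S3 T3.
  set (u := cos (A * x)) in *; set (v := sin (A * x)) in *.
  set (w := cos (2 * A * x)) in *; set (z := sin (2 * A * x)) in *.
  set (c0 := csum 0 0 (RSP t) x) in *; set (s0 := ssum 0 0 (RSP t) x) in *.
  set (c1 := csum 1 0 (RSP t) x) in *; set (s1 := ssum 1 0 (RSP t) x) in *.
  set (c2 := csum 2 0 (RSP t) x) in *; set (s2 := ssum 2 0 (RSP t) x) in *.
  set (c3 := csum 3 0 (RSP t) x) in *; set (s3 := ssum 3 0 (RSP t) x) in *.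
  set (d0 := csum 0 0 (RSQ t) x) in *; set (e0 := ssum 0 0 (RSQ t) x) in *.
  set (d1 := csum 1 0 (RSQ t) x) in *; set (e1 := ssum 1 0 (RSQ t) x) in *.
  set (d2 := csum 2 0 (RSQ t) x) in *; set (e2 := ssum 2 0 (RSQ t) x) in *.
  set (d3 := csum 3 0 (RSQ t) x) in *; set (e3 := ssum 3 0 (RSQ t) x) in *.
  assert (L : forall a b c d r, 0 <= r -> a ^ 2 + b ^ 2 + c ^ 2 + d ^ 2 <= r ^ 2 ->
     (- r <= u * a - v * b <= r) /\ (- r <= v * a + u * b <= r) /\
     (- r <= w * c - z * d <= r) /\ (- r <= z * c + w * d <= r)).
  { intros a b c d r Hr H.
    pose proof (pow2_ge_0 a); pose proof (pow2_ge_0 b).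
    pose proof (pow2_ge_0 c); pose proof (pow2_ge_0 d).
    destruct (rot_le u v a b r Hr Hu) as [G1 G2]; [lra|].
    destruct (rot_le w z c d r Hr Hw) as [G3 G4]; [lra|].
    refine (conj _ (conj _ (conj _ _))); apply Rabs_le_bounds; assumption. }
  assert (HNR : 0 <= N * Rt) by nra.
  assert (HN2 : 0 <= N ^ 2 * Rt) by (apply Rmult_le_pos; [apply pow_le|]; lra).
  assert (HN3 : 0 <= N ^ 3 * Rt) by (apply Rmult_le_pos; [apply pow_le|]; lra).
  destruct (L _ _ _ _ _ HNR B1) as (P1 & P1' & Q1 & Q1').
  destruct (L _ _ _ _ _ HN2 B2) as (P2 & P2' & Q2 & Q2').
  destruct (L _ _ _ _ _ HN3 B3) as (P3 & P3' & Q3 & Q3').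
  clear L B1 B2 B3.
  (* The real and imaginary parts of [e^(iAx) P_t] and [e^(2iAx) Q_t]. *)
  exists (u * c0 - v * s0), (v * c0 + u * s0), (w * d0 - z * e0), (z * d0 + w * e0).
  split; [|split; [|split; [|split]]].
  - pose proof (rot_sq u v c0 s0 Hu). pose proof (rot_sq w z d0 e0 Hw). lra.
  - ring.
  - rewrite EA.
    match goal with |- Rabs ?X <= _ =>
      replace X with (- ((v * c1 + u * s1) + (z * d1 + w * e1))) by ring end.
    apply Rabs_le; lra.
  - match goal with |- Rabs ?X <= _ =>
      replace X with (- (2 * A * (v * 0 + u * c1 - v * s1) + 4 * A * (w * d1 - z * e1)
        + (u * c2 - v * s2) + (w * d2 - z * e2))) by ring end.
    assert (H1 : - (N * (N * Rt)) <= N * (u * c1 - v * s1) <= N * (N * Rt)) by (split; nra).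
    assert (H2 : - (N * (N * Rt)) <= N * (w * d1 - z * e1) <= N * (N * Rt)) by (split; nra).
    rewrite EA; apply Rabs_le; simpl in *; lra.
  - match goal with |- Rabs ?X <= _ =>
      replace X with (3 * A ^ 2 * (v * c1 + u * s1) + 12 * A ^ 2 * (z * d1 + w * e1)
        + 3 * A * (v * c2 + u * s2) + 6 * A * (z * d2 + w * e2)
        + (v * c3 + u * s3) + (z * d3 + w * e3)) by ring end.
    assert (HNN : 0 <= N ^ 2) by (apply pow_le; lra).
    assert (H1 : - (N ^ 2 * (N * Rt)) <= N ^ 2 * (v * c1 + u * s1) <= N ^ 2 * (N * Rt)) by (split; nra).
    assert (H2 : - (N ^ 2 * (N * Rt)) <= N ^ 2 * (z * d1 + w * e1) <= N ^ 2 * (N * Rt)) by (split; nra).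
    assert (H3 : - (N * (N ^ 2 * Rt)) <= N * (v * c2 + u * s2) <= N * (N ^ 2 * Rt)) by (split; nra).
    assert (H4 : - (N * (N ^ 2 * Rt)) <= N * (z * d2 + w * e2) <= N * (N ^ 2 * Rt)) by (split; nra).
    rewrite EA; apply Rabs_le; simpl in *; lra.
Qed.

(** Each of [p0, p1, q0, q1] is at most [amp t] in absolute value, so the main terms have weights 2,
    3, 5 and 9; the constant 10 also covers the errors of [RSF_jet]. *)
Lemma RSF_upper t x :
  let A := 2 ^ (t + 10) in
  Rabs (RSF 0 t x) <= 2 * amp t /\
  Rabs (RSF 1 t x) <= 10 * (A * amp t) /\
  Rabs (RSF 2 t x) <= 10 * (A ^ 2 * amp t) /\
  Rabs (RSF 3 t x) <= 10 * (A ^ 3 * amp t).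
Proof.
  destruct (RSF_jet t x) as (p0 & p1 & q0 & q1 & H & H0 & H1 & H2 & H3).
  cbv zeta. assert (HA : 0 < 2 ^ (t + 10)) by (apply pow_lt; lra).
  set (A := 2 ^ (t + 10)) in *. pose proof (amp_pos t) as HR.
  apply Rabs_le_bounds in H1, H2, H3.
  assert (L : forall y, y ^ 2 <= amp t ^ 2 -> - amp t <= y <= amp t).
  { intros y Hy; apply Rabs_le_bounds; rewrite <- (Rabs_right (amp t)) by lra.
    apply Rsqr_le_abs_0; unfold Rsqr; lra. }
  pose proof (pow2_ge_0 p0); pose proof (pow2_ge_0 p1).
  pose proof (pow2_ge_0 q0); pose proof (pow2_ge_0 q1).
  pose proof (L p0 ltac:(lra)); pose proof (L p1 ltac:(lra)).
  pose proof (L q0 ltac:(lra)); pose proof (L q1 ltac:(lra)).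
  assert (M : forall B y k, 0 < B -> - (k * amp t) <= y <= k * amp t ->
     - (k * (B * amp t)) <= B * y <= k * (B * amp t)) by (intros; split; nra).
  pose proof (M A (p1 + 2 * q1) 3 HA ltac:(lra)).
  pose proof (M (A ^ 2) (p0 + 4 * q0) 5 (pow_lt _ _ HA) ltac:(lra)).
  pose proof (M (A ^ 3) (p1 + 8 * q1) 9 (pow_lt _ _ HA) ltac:(lra)).
  assert (0 < A * amp t) by (apply Rmult_lt_0_compat; lra).
  assert (0 < A ^ 2 * amp t) by (apply Rmult_lt_0_compat; [apply pow_lt|]; lra).
  assert (0 < A ^ 3 * amp t) by (apply Rmult_lt_0_compat; [apply pow_lt|]; lra).
  rewrite H0; repeat split; apply Rabs_le; lra.
Qed.

(** The values [p0 + q0] and [p0 + 4 q0] determine [p0, q0], while [p1 + 2 q1] and [p1 + 8 q1]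
    determine [p1, q1]. If all are small, each of the four is at most [amp t / 10], against their
    sum of squares [amp t ^ 2]. *)
Lemma RSF_nondegenerate t x :
  let A := 2 ^ (t + 10) in
  Rabs (RSF 0 t x) <= / 50 * amp t ->
  Rabs (RSF 1 t x) <= / 50 * (A * amp t) ->
  Rabs (RSF 2 t x) <= / 50 * (A ^ 2 * amp t) ->
  Rabs (RSF 3 t x) <= / 20 * (A ^ 3 * amp t) -> False.
Proof.
  destruct (RSF_jet t x) as (p0 & p1 & q0 & q1 & H & H0 & H1 & H2 & H3).
  cbv zeta. assert (HA : 0 < 2 ^ (t + 10)) by (apply pow_lt; lra).
  set (A := 2 ^ (t + 10)) in *. pose proof (amp_pos t) as HR.
  intros F0 F1 F2 F3.
  apply Rabs_le_bounds in H1, H2, H3, F0, F1, F2, F3.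
  assert (M : forall B y k, 0 < B -> - (k * (B * amp t)) <= B * y <= k * (B * amp t) ->
     - (k * amp t) <= y <= k * amp t).
  { intros B y k HB [? ?]; split; apply Rmult_le_reg_l with B; lra. }
  pose proof (M A (p1 + 2 * q1) (3 / 100) HA ltac:(lra)).
  pose proof (M (A ^ 2) (p0 + 4 * q0) (3 / 100) (pow_lt _ _ HA) ltac:(lra)).
  pose proof (M (A ^ 3) (p1 + 8 * q1) (7 / 100) (pow_lt _ _ HA) ltac:(lra)).
  rewrite H0 in F0.
  assert (S : forall y, - (amp t / 10) <= y <= amp t / 10 -> y ^ 2 <= amp t ^ 2 / 100).
  { intros y Hy; nra. }
  pose proof (S p0 ltac:(lra)); pose proof (S p1 ltac:(lra)).
  pose proof (S q0 ltac:(lra)); pose proof (S q1 ltac:(lra)).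
  pose proof (pow_lt _ 2 HR). lra.
Qed.

(** * Sublevel sets and interpolation *)

Lemma rolle_lim (g g' : R -> R) a b :
  (forall x, derivable_pt_lim g x (g' x)) -> a < b -> g a = 0 -> g b = 0 ->
  exists c, a < c < b /\ g' c = 0.
Proof.
  intros Hg Hab Ha Hb.
  destruct (MVT_cor2 g g' a b Hab) as (c & E & Hc); [intros; apply Hg|].
  exists c; split; [exact Hc|]. rewrite Ha, Hb in E.
  apply Rmult_eq_reg_r with (b - a); lra.
Qed.

Lemma mvt_bound (g g' : R -> R) M a b :
  (forall x, derivable_pt_lim g x (g' x)) -> (forall x, Rabs (g' x) <= M) ->
  Rabs (g b - g a) <= M * Rabs (b - a).
Proof.
  intros Hg HM.
  assert (K : forall a b, a < b -> Rabs (g b - g a) <= M * Rabs (b - a)).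
  { intros u v Huv. destruct (MVT_cor2 g g' u v Huv) as (c & E & _); [intros; apply Hg|].
    rewrite E, Rabs_mult. apply Rmult_le_compat_r; [apply Rabs_pos|apply HM]. }
  destruct (Rtotal_order a b) as [H|[->|H]]; auto.
  - rewrite !Rminus_diag, Rabs_R0; lra.
  - rewrite Rabs_minus_sym, (Rabs_minus_sym b); auto.
Qed.

Lemma div_diff_bound a b c M k :
  0 < k -> k <= c -> Rabs a <= M -> Rabs b <= M -> Rabs ((a - b) / c) <= 2 * M / k.
Proof.
  intros Hk Hc Ha Hb. pose proof (Rabs_pos a).
  unfold Rdiv; rewrite Rabs_mult, (Rabs_right (/ c));
    [|left; apply Rinv_0_lt_compat; lra].
  apply Rmult_le_compat; [apply Rabs_pos|left; apply Rinv_0_lt_compat; lra| |].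
  - unfold Rminus; eapply Rle_trans; [apply Rabs_triang|rewrite Rabs_Ropp; lra].
  - apply Rinv_le_contravar; lra.
Qed.

(** The fourth interpolation node enters only through the divided difference [d3]. *)
Definition newton3 (x0 x1 x2 d0 d1 d2 d3 : R) (j : nat) (x : R) : R :=
  match j with
  | 0%nat => d0 + d1 * (x - x0) + d2 * ((x - x0) * (x - x1))
             + d3 * ((x - x0) * (x - x1) * (x - x2))
  | 1%nat => d1 + d2 * (2 * x - x0 - x1)
             + d3 * ((x - x1) * (x - x2) + (x - x0) * (x - x2) + (x - x0) * (x - x1))
  | 2%nat => 2 * d2 + d3 * (6 * x - 2 * x0 - 2 * x1 - 2 * x2)
  | _ => 6 * d3
  end.

Lemma derivable_pt_lim_cubic a b c d x :
  derivable_pt_lim (fun y => a + b * y + c * y ^ 2 + d * y ^ 3) x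
    (b + 2 * c * x + 3 * d * x ^ 2).
Proof.
  replace (b + 2 * c * x + 3 * d * x ^ 2)
    with (0 + b + c * (INR 2 * x ^ pred 2) + d * (INR 3 * x ^ pred 3)) by (simpl; ring).
  apply (derivable_pt_lim_plus (fun y => a + b * y + c * y ^ 2) (fun y => d * y ^ 3)).
  - apply (derivable_pt_lim_plus (fun y => a + b * y) (fun y => c * y ^ 2)).
    + apply (derivable_pt_lim_plus (fun _ => a) (fun y => b * y)).
      * apply derivable_pt_lim_const.
      * apply derivable_pt_lim_linear.
    + apply (derivable_pt_lim_scal (fun y => y ^ 2)), derivable_pt_lim_pow.
  - apply (derivable_pt_lim_scal (fun y => y ^ 3)), derivable_pt_lim_pow.
Qed.

Lemma derivable_pt_lim_eq f g x l m :
  derivable_pt_lim f x l -> (forall y, f y = g y) -> l = m -> derivable_pt_lim g x m.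
Proof.
  intros H E <- eps He; destruct (H eps He) as [d Hd]; exists d.
  intros h; rewrite <- !E; apply Hd.
Qed.

Lemma newton3_deriv x0 x1 x2 d0 d1 d2 d3 j x :
  (j < 3)%nat ->
  derivable_pt_lim (newton3 x0 x1 x2 d0 d1 d2 d3 j) x (newton3 x0 x1 x2 d0 d1 d2 d3 (S j) x).
Proof.
  intros Hj; destruct j as [|[|[|j]]]; [| | |lia]; cbn [newton3].
  - apply (derivable_pt_lim_eq _ _ _ _ _ (derivable_pt_lim_cubic
      (d0 - d1 * x0 + d2 * x0 * x1 - d3 * x0 * x1 * x2)
      (d1 - d2 * (x0 + x1) + d3 * (x0 * x1 + x0 * x2 + x1 * x2))
      (d2 - d3 * (x0 + x1 + x2)) d3 x)); intros; cbn [newton3]; ring.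
  - apply (derivable_pt_lim_eq _ _ _ _ _ (derivable_pt_lim_cubic
      (d1 - d2 * (x0 + x1) + d3 * (x0 * x1 + x0 * x2 + x1 * x2))
      (2 * (d2 - d3 * (x0 + x1 + x2))) (3 * d3) 0 x)); intros; cbn [newton3]; ring.
  - apply (derivable_pt_lim_eq _ _ _ _ _ (derivable_pt_lim_cubic
      (2 * (d2 - d3 * (x0 + x1 + x2))) (6 * d3) 0 0 x)); intros; cbn [newton3]; ring.
Qed.
(** Subtracting the cubic interpolant leaves a function with four zeros. By Rolle its first three
    derivatives vanish somewhere, and there the derivatives of [F 0] equal those of the cubic, which
    are controlled by divided differences. *)
Lemma four_small_values (F : nat -> R -> R) h eta x0 x1 x2 x3 :
  (forall j x, (j < 3)%nat -> derivable_pt_lim (F j) x (F (S j) x)) ->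
  0 < h -> x0 + h <= x1 -> x1 + h <= x2 -> x2 + h <= x3 -> x3 <= x0 + 7 * h ->
  Rabs (F 0%nat x0) <= eta -> Rabs (F 0%nat x1) <= eta ->
  Rabs (F 0%nat x2) <= eta -> Rabs (F 0%nat x3) <= eta ->
  exists y1 y2 y3,
    x0 <= y1 <= x3 /\ x0 <= y2 <= x3 /\ x0 <= y3 <= x3 /\
    Rabs (F 1%nat y1) <= 226 * (eta / h) /\
    Rabs (F 2%nat y2) <= 60 * (eta / h ^ 2) /\
    Rabs (F 3%nat y3) <= 8 * (eta / h ^ 3).
Proof.
  intros HF Hh G1 G2 G3 Hw B0 B1 B2 B3.
  set (f := F 0%nat) in *.
  set (d1 := (f x1 - f x0) / (x1 - x0)).
  set (e1 := (f x2 - f x1) / (x2 - x1)).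
  set (k1 := (f x3 - f x2) / (x3 - x2)).
  set (d2 := (e1 - d1) / (x2 - x0)).
  set (e2 := (k1 - e1) / (x3 - x1)).
  set (d3 := (e2 - d2) / (x3 - x0)).
  (* A divided difference of order [j] has a denominator of at least [j h], which yields the factors
     2, 2 and 4/3. *)
  assert (Bd1 : Rabs d1 <= 2 * eta / h) by (apply div_diff_bound; lra).
  assert (Be1 : Rabs e1 <= 2 * eta / h) by (apply div_diff_bound; lra).
  assert (Bk1 : Rabs k1 <= 2 * eta / h) by (apply div_diff_bound; lra).
  assert (Bd2 : Rabs d2 <= 2 * (2 * eta / h) / (2 * h)) by (apply div_diff_bound; lra).
  assert (Be2 : Rabs e2 <= 2 * (2 * eta / h) / (2 * h)) by (apply div_diff_bound; lra).
  assert (Bd3 : Rabs d3 <= 2 * (2 * (2 * eta / h) / (2 * h)) / (3 * h))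
    by (apply div_diff_bound; lra).
  set (p := newton3 x0 x1 x2 (f x0) d1 d2 d3).
  pose (g := fun j x => F j x - p j x).
  assert (Hg : forall j x, (j < 3)%nat -> derivable_pt_lim (g j) x (g (S j) x)).
  { intros j x Hj. apply (derivable_pt_lim_minus (F j) (p j)).
    - apply HF, Hj.
    - apply newton3_deriv, Hj. }
  assert (Z0 : g 0%nat x0 = 0) by (unfold g, p; cbn [newton3]; fold f; ring).
  assert (Z1 : g 0%nat x1 = 0)
    by (unfold g, p; cbn [newton3]; fold f; unfold d1; field; lra).
  assert (Z2 : g 0%nat x2 = 0)
    by (unfold g, p; cbn [newton3]; fold f; unfold d2, e1, d1; field; lra).
  assert (Z3 : g 0%nat x3 = 0)
    by (unfold g, p; cbn [newton3]; fold f; unfold d3, e2, d2, k1, e1, d1; field; lra).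
  assert (L0 : (0 < 3)%nat) by lia. assert (L1 : (1 < 3)%nat) by lia.
  assert (L2 : (2 < 3)%nat) by lia.
  destruct (rolle_lim _ _ x0 x1 (fun x => Hg _ x L0)) as (a1 & A1 & Ga1); [lra|auto|auto|].
  destruct (rolle_lim _ _ x1 x2 (fun x => Hg _ x L0)) as (a2 & A2 & Ga2); [lra|auto|auto|].
  destruct (rolle_lim _ _ x2 x3 (fun x => Hg _ x L0)) as (a3 & A3 & Ga3); [lra|auto|auto|].
  destruct (rolle_lim _ _ a1 a2 (fun x => Hg _ x L1)) as (b1 & Hb1 & Gb1); [lra|auto|auto|].
  destruct (rolle_lim _ _ a2 a3 (fun x => Hg _ x L1)) as (b2 & Hb2 & Gb2); [lra|auto|auto|].
  destruct (rolle_lim _ _ b1 b2 (fun x => Hg _ x L2)) as (c & Hc & Gc); [lra|auto|auto|].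
  exists a1, b1, c. refine (conj _ (conj _ (conj _ _))); [lra|lra|lra|].
  assert (Heta : 0 <= eta) by (pose proof (Rabs_pos (f x0)); lra).
  assert (Hih : 0 < / h) by (apply Rinv_0_lt_compat; lra).
  replace (2 * eta / h) with (2 * (eta / h)) in Bd1 by (field; lra).
  replace (2 * (2 * eta / h) / (2 * h)) with (2 * (eta / h ^ 2)) in Bd2 by (field; lra).
  replace (2 * (2 * (2 * eta / h) / (2 * h)) / (3 * h)) with (4 / 3 * (eta / h ^ 3)) in Bd3
    by (field; lra).
  assert (P : forall a b X Y, Rabs a <= X -> - Y <= b <= Y -> Rabs (a * b) <= X * Y).
  { intros a b X Y Ha Hb; rewrite Rabs_mult.
    apply Rmult_le_compat; try apply Rabs_pos; auto; apply Rabs_le; auto. }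
  refine (conj _ (conj _ _)).
  (* All nodes lie within [7 h], so the three terms contribute [2 + 28 + 196 = 226]; likewise
     [4 + 56 = 60] and [6 * 4/3 = 8] for the next two derivatives. *)
  - replace (F 1%nat a1) with (p 1%nat a1) by (unfold g in Ga1; lra).
    unfold p; cbn [newton3].
    pose proof (P d2 (2 * a1 - x0 - x1) _ (14 * h) Bd2 ltac:(lra)) as Q2.
    assert (W : - (3 * 49 * (h * h)) <=
      (a1 - x1) * (a1 - x2) + (a1 - x0) * (a1 - x2) + (a1 - x0) * (a1 - x1)
      <= 3 * 49 * (h * h)).
    { assert (W : forall a b, - (7 * h) <= a <= 7 * h -> - (7 * h) <= b <= 7 * h ->
        - (49 * (h * h)) <= a * b <= 49 * (h * h)) by (intros; split; nra).
      pose proof (W (a1 - x1) (a1 - x2) ltac:(lra) ltac:(lra)).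
      pose proof (W (a1 - x0) (a1 - x2) ltac:(lra) ltac:(lra)).
      pose proof (W (a1 - x0) (a1 - x1) ltac:(lra) ltac:(lra)). lra. }
    pose proof (P d3 _ _ _ Bd3 W) as Q3.
    replace (2 * (eta / h ^ 2) * (14 * h)) with (28 * (eta / h)) in Q2 by (field; lra).
    replace (4 / 3 * (eta / h ^ 3) * (3 * 49 * (h * h))) with (196 * (eta / h)) in Q3
      by (field; lra).
    eapply Rle_trans; [apply Rabs_triang|].
    eapply Rle_trans; [apply Rplus_le_compat_r, Rabs_triang|]. lra.
  - replace (F 2%nat b1) with (p 2%nat b1) by (unfold g in Gb1; lra).
    unfold p; cbn [newton3].
    pose proof (P d3 (6 * b1 - 2 * x0 - 2 * x1 - 2 * x2) _ (42 * h) Bd3 ltac:(lra)) as Q3.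
    replace (4 / 3 * (eta / h ^ 3) * (42 * h)) with (56 * (eta / h ^ 2)) in Q3
      by (field; lra).
    eapply Rle_trans; [apply Rabs_triang|].
    rewrite Rabs_mult, (Rabs_right 2) by lra. lra.
  - replace (F 3%nat c) with (p 3%nat c) by (unfold g in Gc; lra).
    unfold p; cbn [newton3]. rewrite Rabs_mult, (Rabs_right 6) by lra. lra.
Qed.

(** The constant 160 makes the bound [8 eta / h^3] on the third derivative equal to the threshold
    1/20 of [RSF_nondegenerate]; the smallness of [h A] takes care of the lower orders. *)
Lemma RSF_four_small t h eta x0 x1 x2 x3 :
  0 < h -> h * 2 ^ (t + 10) <= / 10000 ->
  eta <= (h * 2 ^ (t + 10)) ^ 3 * amp t / 160 ->
  x0 + h <= x1 -> x1 + h <= x2 -> x2 + h <= x3 -> x3 <= x0 + 7 * h ->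
  Rabs (RSF 0 t x0) <= eta -> Rabs (RSF 0 t x1) <= eta ->
  Rabs (RSF 0 t x2) <= eta -> Rabs (RSF 0 t x3) <= eta -> False.
Proof.
  intros Hh Hk He G1 G2 G3 Hw B0 B1 B2 B3.
  destruct (four_small_values (fun j => RSF j t) h eta x0 x1 x2 x3
    (fun j x => RSF_deriv j t x) Hh G1 G2 G3 Hw B0 B1 B2 B3)
    as (y1 & y2 & y3 & Y1 & Y2 & Y3 & D1 & D2 & D3).
  pose proof (fun x => RSF_upper t x) as U.
  assert (HA : 0 < 2 ^ (t + 10)) by (apply pow_lt; lra).
  set (A := 2 ^ (t + 10)) in *. cbv zeta in U. pose proof (amp_pos t) as HR.
  set (r := amp t) in *.
  (* The small values occur at different points. The mean value theorem moves them all to [y3], at a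
     cost of [70 h A] in the relevant unit. *)
  assert (M : forall j K y, (j < 3)%nat -> (forall x, Rabs (RSF (S j) t x) <= K) ->
    x0 <= y <= x3 -> Rabs (RSF j t y3) <= Rabs (RSF j t y) + 7 * h * K).
  { intros j K y Hj HK Hy.
    pose proof (mvt_bound (RSF j t) (RSF (S j) t) K y y3
      (fun x => RSF_deriv j t x Hj) HK) as V.
    assert (Rabs (y3 - y) <= 7 * h) by (apply Rabs_le; lra).
    assert (HK0 : 0 <= K) by (eapply Rle_trans; [apply Rabs_pos|apply (HK 0)]).
    assert (K * Rabs (y3 - y) <= 7 * h * K) by nra.
    replace (RSF j t y3) with (RSF j t y + (RSF j t y3 - RSF j t y)) by ring.
    eapply Rle_trans; [apply Rabs_triang|]. lra. }
  pose proof (M 0%nat _ x0 ltac:(lia) (fun x => proj1 (proj2 (U x))) ltac:(lra)) as V0.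
  pose proof (M 1%nat _ y1 ltac:(lia) (fun x => proj1 (proj2 (proj2 (U x)))) ltac:(lra)) as V1.
  pose proof (M 2%nat _ y2 ltac:(lia) (fun x => proj2 (proj2 (proj2 (U x)))) ltac:(lra)) as V2.
  clear M U.
  assert (Hp : 0 < h * A) by (apply Rmult_lt_0_compat; lra).
  set (k := h * A) in *.
  assert (E1 : eta / h <= k ^ 2 / 160 * (A * r)).
  { apply Rmult_le_reg_r with h; [lra|]. unfold Rdiv at 1; rewrite Rmult_assoc, Rinv_l by lra.
    unfold k in *; lra. }
  assert (E2 : eta / h ^ 2 <= k / 160 * (A ^ 2 * r)).
  { pose proof (pow_lt _ 2 Hh). apply Rmult_le_reg_r with (h ^ 2); [lra|].
    unfold Rdiv at 1; rewrite Rmult_assoc, Rinv_l by lra. unfold k in *; lra. }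
  assert (E3 : eta / h ^ 3 <= 1 / 160 * (A ^ 3 * r)).
  { pose proof (pow_lt _ 3 Hh). apply Rmult_le_reg_r with (h ^ 3); [lra|].
    unfold Rdiv at 1; rewrite Rmult_assoc, Rinv_l by lra. unfold k in *; lra. }
  assert (k2 : k ^ 2 <= / 10000) by (simpl; nra).
  assert (k3 : k ^ 3 <= / 10000) by (replace (k ^ 3) with (k * k ^ 2) by ring; nra).
  assert (T : forall a b Y, 0 <= Y -> a <= b -> a * Y <= b * Y)
    by (intros; apply Rmult_le_compat_r; auto).
  assert (P1 : 0 < A * r) by (apply Rmult_lt_0_compat; lra).
  assert (P2 : 0 < A ^ 2 * r) by (apply Rmult_lt_0_compat; [apply pow_lt|]; lra).
  assert (P3 : 0 < A ^ 3 * r) by (apply Rmult_lt_0_compat; [apply pow_lt|]; lra).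
  apply (RSF_nondegenerate t y3); cbv zeta; fold A; fold r.
  - pose proof (T _ _ r ltac:(lra) Hk). pose proof (T _ _ r ltac:(lra) k3).
    replace (7 * h * (10 * (A * r))) with (70 * (k * r)) in V0 by (unfold k; ring). lra.
  - pose proof (T _ _ (A * r) ltac:(lra) Hk). pose proof (T _ _ (A * r) ltac:(lra) k2).
    replace (7 * h * (10 * (A ^ 2 * r))) with (70 * (k * (A * r))) in V1 by (unfold k; ring).
    lra.
  - pose proof (T _ _ (A ^ 2 * r) ltac:(lra) Hk).
    replace (7 * h * (10 * (A ^ 3 * r))) with (70 * (k * (A ^ 2 * r))) in V2
      by (unfold k; ring). lra.
  - lra.
Qed.

(** * Values at [0] and [PI], and polynomial functions of [cos] *)

Lemma cos_period_Z x k : cos (x + 2 * PI * IZR k) = cos x.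
Proof.
  destruct (Z_le_gt_dec 0 k) as [H|H].
  - rewrite <- (Z2Nat.id k H), <- INR_IZR_INZ.
    replace (2 * PI * INR (Z.to_nat k)) with (2 * INR (Z.to_nat k) * PI) by ring.
    apply cos_period.
  - rewrite <- (cos_period (x + 2 * PI * IZR k) (Z.to_nat (- k))).
    rewrite INR_IZR_INZ, Z2Nat.id by lia. rewrite opp_IZR. f_equal; ring.
Qed.

Lemma csum_even j a L x : csum j a L (- x) = csum j a L x.
Proof.
  revert a; induction L as [|e L IH]; intros a; [reflexivity|].
  cbn [csum]; rewrite IH, Ropp_mult_distr_r_reverse, cos_neg; reflexivity.
Qed.

Lemma csum_period j m L x k : csum j (INR m) L (x + 2 * PI * IZR k) = csum j (INR m) L x.
Proof.
  revert m; induction L as [|e L IH]; intros m; [reflexivity|].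
  cbn [csum]; rewrite <- S_INR, IH. do 2 f_equal.
  rewrite Rmult_plus_distr_l, INR_IZR_INZ.
  replace (IZR (Z.of_nat m) * (2 * PI * IZR k)) with (2 * PI * (IZR (Z.of_nat m) * IZR k)) by ring.
  rewrite <- mult_IZR; apply cos_period_Z.
Qed.

Lemma RSF_even t x : RSF 0 t (- x) = RSF 0 t x.
Proof. cbn [RSF]; rewrite !csum_even; reflexivity. Qed.

Lemma RSF_period t x k : RSF 0 t (x + 2 * PI * IZR k) = RSF 0 t x.
Proof. cbn [RSF]; rewrite <- !INR_pow2, !csum_period; reflexivity. Qed.

(** At such [x] one step of the recursion sends [(P, Q)] to [(P + Q, P - Q)], so two steps double
    both. The factor [z^(2^0)], which is -1 at [x = PI], cancels from the sum in the base case. *)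
Lemma RS_double x s :
  (forall j, (1 <= j)%nat -> cos (2 ^ j * x) = 1 /\ sin (2 ^ j * x) = 0) ->
  csum 0 0 (RSP (2 * s + 1)) x + csum 0 0 (RSQ (2 * s + 1)) x = 2 ^ S s.
Proof.
  intros H.
  assert (R1 : forall t, (1 <= t)%nat ->
    csum 0 0 (RSP (S t)) x = csum 0 0 (RSP t) x + csum 0 0 (RSQ t) x /\
    csum 0 0 (RSQ (S t)) x = csum 0 0 (RSP t) x - csum 0 0 (RSQ t) x).
  { intros t Ht. destruct (H t Ht) as [C S].
    rewrite RSP_S, RSQ_S, !csum_app, csum_opp, (proj1 (RS_length t)), INR_pow2.
    rewrite (proj1 (csum_shift 0 _ _ _ _ ltac:(lia))), C, S. cbn [shifted]. split; ring. }
  induction s as [|s IH].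
  - change (2 * 0 + 1)%nat with 1%nat. rewrite RSP_S, RSQ_S, !csum_app, csum_opp.
    simpl; rewrite Rmult_0_l, cos_0; ring.
  - replace (2 * S s + 1)%nat with (S (S (2 * s + 1))) by lia.
    destruct (R1 (S (2 * s + 1)) ltac:(lia)) as [-> ->].
    destruct (R1 (2 * s + 1)%nat ltac:(lia)) as [-> ->].
    change (2 ^ S (S s)) with (2 * 2 ^ S s). rewrite <- IH; ring.
Qed.

(** For odd [t] the number [2^(t+1)] is a perfect square, and its root is the value found in
    [RS_double]. *)
Lemma amp_odd s : amp (2 * s + 1) = 2 ^ S s.
Proof.
  unfold amp. replace (S (2 * s + 1)) with (S s * 2)%nat by lia.
  rewrite pow_mult. apply sqrt_pow2, pow_le; lra.
Qed.

Lemma RSF_at t x :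
  Nat.Odd t -> (forall j, (1 <= j)%nat -> cos (2 ^ j * x) = 1 /\ sin (2 ^ j * x) = 0) ->
  RSF 0 t x = amp t.
Proof.
  intros [s ->] H. rewrite amp_odd, <- (RS_double x s H). cbn [RSF].
  destruct (H (2 * s + 1 + 10)%nat ltac:(lia)) as [C1 S1].
  destruct (H (2 * s + 1 + 11)%nat ltac:(lia)) as [C2 S2].
  set (A := 2 ^ (2 * s + 1 + 10)) in *; set (B := 2 ^ (2 * s + 1 + 11)) in *.
  pose proof (proj1 (csum_shift 0 A (RSP (2 * s + 1)) 0 x ltac:(lia))) as E1.
  pose proof (proj1 (csum_shift 0 B (RSQ (2 * s + 1)) 0 x ltac:(lia))) as E2.
  cbn [shifted] in *; rewrite Rplus_0_r in E1, E2.
  rewrite E1, E2, C1, S1, C2, S2; ring.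
Qed.

Lemma RSF_0 t : Nat.Odd t -> RSF 0 t 0 = amp t.
Proof. intros H; apply RSF_at; [exact H|]; intros j _; rewrite Rmult_0_r, cos_0, sin_0; auto. Qed.

Lemma RSF_PI t : Nat.Odd t -> RSF 0 t PI = amp t.
Proof.
  intros H; apply RSF_at; [exact H|]; intros [|j] Hj; [lia|].
  pose proof (cos_period 0 (2 ^ j)) as C; pose proof (sin_period 0 (2 ^ j)) as C'.
  rewrite INR_pow2, Rplus_0_l in C, C'.
  change (2 ^ S j) with (2 * 2 ^ j). rewrite C, C', cos_0, sin_0; auto.
Qed.

(** Over a distance [110 h] the function moves by at most [1100 h A amp t], which is at most
    [0.11 amp t]. *)
Lemma RSF_near t h x x0 :
  RSF 0 t x0 = amp t -> 0 < h -> h * 2 ^ (t + 10) <= / 10000 ->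
  Rabs (x - x0) <= 110 * h -> amp t / 2 <= Rabs (RSF 0 t x).
Proof.
  intros E Hh Hk Hx.
  pose proof (mvt_bound (RSF 0 t) (RSF 1 t) _ x0 x
    (fun y => RSF_deriv 0 t y ltac:(lia)) (fun y => proj1 (proj2 (RSF_upper t y)))) as M.
  cbv zeta in M. assert (HA : 0 < 2 ^ (t + 10)) by (apply pow_lt; lra).
  set (A := 2 ^ (t + 10)) in *. pose proof (amp_pos t) as HR. set (r := amp t) in *.
  rewrite E in M. apply Rabs_le_bounds in M.
  assert (K : 10 * (A * r) * Rabs (x - x0) <= 10 * (A * r) * (110 * h))
    by (apply Rmult_le_compat_l; [nra|exact Hx]).
  assert (K2 : h * A * r <= / 10000 * r) by (apply Rmult_le_compat_r; lra).
  eapply Rle_trans; [|apply Rle_abs]. lra.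
Qed.

(* [poly_fun d f]: [f] is a polynomial function of degree at most [d], in Horner form. *)
Fixpoint poly_fun (d : nat) (f : R -> R) : Prop :=
  match d with
  | O => exists c, forall x, f x = c
  | S d' => exists c g, poly_fun d' g /\ forall x, f x = c + x * g x
  end.

Lemma poly_fun_ext d f g : (forall x, f x = g x) -> poly_fun d f -> poly_fun d g.
Proof.
  intros E; destruct d as [|d]; simpl.
  - intros [c H]; exists c; intros; rewrite <- E; auto.
  - intros (c & k & Hk & H); exists c, k; split; [exact Hk|intros; rewrite <- E; auto].
Qed.

Lemma poly_fun_const d c : poly_fun d (fun _ => c).
Proof.
  revert c; induction d as [|d IH]; intros c; simpl; [exists c; auto|].
  exists c, (fun _ => 0); split; [apply IH|intros; ring].
Qed.

Lemma poly_fun_add d f g : poly_fun d f -> poly_fun d g -> poly_fun d (fun x => f x + g x).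
Proof.
  revert f g; induction d as [|d IH]; simpl; intros f g.
  - intros [c H] [c' H']; exists (c + c'); intros; rewrite H, H'; ring.
  - intros (c & k & Hk & H) (c' & k' & Hk' & H').
    exists (c + c'), (fun x => k x + k' x); split; [auto|intros; rewrite H, H'; ring].
Qed.

Lemma poly_fun_scal d a f : poly_fun d f -> poly_fun d (fun x => a * f x).
Proof.
  revert f; induction d as [|d IH]; simpl; intros f.
  - intros [c H]; exists (a * c); intros; rewrite H; ring.
  - intros (c & k & Hk & H).
    exists (a * c), (fun x => a * k x); split; [auto|intros; rewrite H; ring].
Qed.

Lemma poly_fun_mulX d f : poly_fun d f -> poly_fun (S d) (fun x => x * f x).
Proof. intros H; exists 0, f; split; [exact H|intros; ring]. Qed.

Lemma poly_fun_S d f : poly_fun d f -> poly_fun (S d) f.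
Proof.
  revert f; induction d as [|d IH]; intros f.
  - intros [c H]; exists c, (fun _ => 0); split; [apply poly_fun_const|intros; rewrite H; ring].
  - intros (c & k & Hk & H); exists c, k; split; [apply IH, Hk|exact H].
Qed.

Lemma poly_fun_le d e f : (d <= e)%nat -> poly_fun d f -> poly_fun e f.
Proof. induction 1; intros; [assumption|apply poly_fun_S; auto]. Qed.

Lemma poly_fun_mul d e f g :
  poly_fun d f -> poly_fun e g -> poly_fun (d + e) (fun x => f x * g x).
Proof.
  intros Hf Hg; revert f Hf; induction d as [|d IH]; simpl; intros f.
  - intros [c H]. eapply poly_fun_ext; [|apply (poly_fun_scal _ c _ Hg)].
    intros x; simpl; rewrite H; reflexivity.
  - intros (c & k & Hk & H).
    eapply (poly_fun_ext (S (d + e))); [|apply poly_fun_add;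
      [apply (poly_fun_le e); [lia|apply (poly_fun_scal _ c _ Hg)]
      |apply poly_fun_mulX, IH, Hk]].
    intros x; simpl; rewrite H; ring.
Qed.

Lemma poly_fun_factor d f r :
  poly_fun (S d) f -> exists q, poly_fun d q /\ forall x, f x = f r + (x - r) * q x.
Proof.
  revert f; induction d as [|d IH]; intros f (c & g & Hg & H).
  - exists g; split; [exact Hg|]. destruct Hg as [c' Hc]. intros x; rewrite !H, !Hc; ring.
  - destruct (IH g Hg) as (q & Hq & E).
    exists (fun x => g r + x * q x); split.
    + apply poly_fun_add; [apply poly_fun_const|apply poly_fun_mulX, Hq].
    + intros x; rewrite !H, E; ring.
Qed.

Lemma poly_fun_roots d f L :
  poly_fun d f -> NoDup L -> (forall r, In r L -> f r = 0) -> (d < length L)%nat ->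
  forall x, f x = 0.
Proof.
  revert f L; induction d as [|d IH]; intros f [|r L] Hf Hnd Hr Hl; simpl in Hl; try lia; intros x.
  - destruct Hf as [c Hc]. rewrite Hc, <- (Hc r). apply Hr; left; reflexivity.
  - destruct (poly_fun_factor d f r Hf) as (q & Hq & E).
    inversion Hnd as [|? ? Hn Hnd']; subst.
    rewrite E, (Hr r (or_introl eq_refl)), (IH q L Hq Hnd'); [ring| |lia].
    intros s Hs. assert (s <> r) by (intros ->; contradiction).
    pose proof (E s) as Es. rewrite (Hr r (or_introl eq_refl)), (Hr s (or_intror Hs)) in Es.
    apply Rmult_eq_reg_l with (s - r); lra.
Qed.

Lemma chebyshev m :
  exists T, poly_fun m T /\ forall x, cos (INR m * x) = T (cos x).
Proof.
  (* Two consecutive degrees are carried along for the recurrence [T_(m+2) = 2 y T_(m+1) - T_m]. *)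
  enough (H : (exists T, poly_fun m T /\ forall x, cos (INR m * x) = T (cos x)) /\
     (exists T, poly_fun (S m) T /\ forall x, cos (INR (S m) * x) = T (cos x))) by apply H.
  induction m as [|m [(T & HT & E) (T' & HT' & E')]].
  - split; [exists (fun _ => 1)|exists (fun x => x * 1)].
    + split; [apply poly_fun_const|]. intros x; simpl; rewrite Rmult_0_l; apply cos_0.
    + split; [apply poly_fun_mulX, poly_fun_const|].
      intros x; simpl; rewrite Rmult_1_l; ring.
  - split; [exists T'; auto|].
    exists (fun y => 2 * (y * T' y) + (-1) * T y); split.
    + apply poly_fun_add; [apply poly_fun_scal, poly_fun_mulX, HT'|].
      apply (poly_fun_le m); [lia|apply poly_fun_scal, HT].
    + intros x; rewrite <- E, <- E', !S_INR.
      replace ((INR m + 1 + 1) * x) with ((INR m + 1) * x + x) by ring.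
      replace (INR m * x) with ((INR m + 1) * x - x) by ring.
      rewrite cos_plus, cos_minus; ring.
Qed.

Lemma csum_poly m L d :
  (m + length L <= S d)%nat ->
  exists T, poly_fun d T /\ forall x, csum 0 (INR m) L x = T (cos x).
Proof.
  revert m; induction L as [|e L IH]; intros m Hd.
  - exists (fun _ => 0); split; [apply poly_fun_const|reflexivity].
  - simpl in Hd. destruct (IH (S m) ltac:(lia)) as (T & HT & E).
    destruct (chebyshev m) as (C & HC & E').
    exists (fun y => e * C y + T y); split.
    + apply poly_fun_add; [|exact HT].
      apply (poly_fun_le m); [lia|apply poly_fun_scal, HC].
    + intros x; rewrite <- E, <- E'; cbn [csum]; rewrite S_INR; simpl; ring.
Qed.

(** The degree is the top frequency in [x], that is [gam n t * INR n], the bound wanted for the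
    number of runs. *)
Lemma RSF_poly t :
  exists T, poly_fun (2 ^ (t + 11) + 2 ^ t - 1) T /\ forall x, RSF 0 t x = T (cos x).
Proof.
  assert (0 < 2 ^ t)%nat by (apply Nat.neq_0_lt_0, Nat.pow_nonzero; lia).
  destruct (RS_length t) as [LP LQ].
  destruct (csum_poly (2 ^ (t + 10)) (RSP t) (2 ^ (t + 11) + 2 ^ t - 1)) as (T & HT & E).
  { rewrite LP, !Nat.pow_add_r; simpl; lia. }
  destruct (csum_poly (2 ^ (t + 11)) (RSQ t) (2 ^ (t + 11) + 2 ^ t - 1)) as (T' & HT' & E').
  { rewrite LQ; lia. }
  exists (fun y => T y + T' y); split; [apply poly_fun_add; assumption|].
  intros x; cbn [RSF]; rewrite <- !INR_pow2, E, E'; reflexivity.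
Qed.

(** * Maximal runs of bad cells *)

(** Sign pattern read from right to left: [F] is positive at each [g] and negative at the [p] that
    follows it. If also [F hi > 0], every pair produces a zero in [(g, p)] and another to the right
    of [p], before the next positive point. *)
Fixpoint alternating (F : R -> R) (lo hi : R) (l : list (R * R)) : Prop :=
  match l with
  | nil => True
  | (g, p) :: l' => lo <= g /\ g < p < hi /\ 0 < F g /\ F p < 0 /\ alternating F lo g l'
  end.

Lemma ivt_open (F : R -> R) x y :
  continuity F -> x < y -> F x * F y < 0 -> exists z, x < z < y /\ F z = 0.
Proof.
  intros HF Hxy Hs. destruct (IVT_cor F x y HF) as (z & Hz & E); [lra|lra|].
  exists z; split; [|exact E].
  destruct (Req_dec z x) as [->|]; [rewrite E in Hs; lra|].
  destruct (Req_dec z y) as [->|]; [rewrite E in Hs; lra|]. lra.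
Qed.

Lemma alternating_roots (F : R -> R) lo hi l :
  continuity F -> 0 < F hi -> alternating F lo hi l ->
  exists L, length L = (2 * length l)%nat /\ NoDup L /\
    (forall r, In r L -> lo <= r < hi /\ F r = 0).
Proof.
  intros HF; revert hi; induction l as [|[g p] l IH]; intros hi Hhi Ha.
  - exists nil; repeat split; try constructor; contradiction.
  - destruct Ha as (Hlo & Hgp & Fg & Fp & Ha).
    destruct (IH g Fg Ha) as (L & HL & Hnd & Hr).
    destruct (ivt_open F g p) as (r1 & H1 & E1); [auto|lra|nra|].
    destruct (ivt_open F p hi) as (r2 & H2 & E2); [auto|lra|nra|].
    exists (r2 :: r1 :: L); split; [simpl; lia|split].
    + constructor; [|constructor; auto].
      * intros [H|H]; [lra|]. apply Hr in H; lra.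
      * intros H; apply Hr in H; lra.
    + intros r [<-|[<-|H]]; [lra|lra|]. destruct (Hr r H); lra.
Qed.

(** As [cos] is injective on [[0, PI]], more than [d] pairs would give more than [2 d] distinct
    roots of [T^2 - c], forcing it to vanish identically, against its positivity at [cos hi]. *)
Lemma alternating_count f T d c lo hi l :
  poly_fun d T -> (forall x, f x = T (cos x)) -> continuity f ->
  0 <= lo -> hi <= PI -> 0 < f hi ^ 2 - c ->
  alternating (fun x => f x ^ 2 - c) lo hi l -> (length l <= d)%nat.
Proof.
  intros HT E Hf Hlo Hhi Fhi Ha.
  assert (HF : continuity (fun x => f x ^ 2 - c)).
  { apply (continuity_minus (fun x => f x ^ 2) (fun _ => c)).
    - apply (continuity_comp f (fun y => y ^ 2)); [exact Hf|].
      apply derivable_continuous, derivable_pow.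
    - apply continuity_const; intros ? ?; reflexivity. }
  destruct (alternating_roots _ _ _ _ HF Fhi Ha) as (L & HL & Hnd & Hr).
  destruct (Nat.le_gt_cases (length l) d) as [|Hd]; [assumption|exfalso].
  enough (Z : (fun y => T y * T y + - c) (cos hi) = 0).
  { cbv beta in Z. rewrite E in Fhi. simpl in Fhi; lra. }
  apply (poly_fun_roots (d + d) (fun y => T y * T y + - c) (map cos L)).
  - apply (poly_fun_add _ (fun y => T y * T y)); [|apply poly_fun_const].
    apply (poly_fun_mul _ _ T); exact HT.
  - clear HL Ha. induction L as [|r L IH]; simpl; [constructor|].
    inversion Hnd as [|? ? Hn Hnd']; subst. constructor.
    + intros H; apply in_map_iff in H; destruct H as (s & Es & Hs).
      destruct (Hr r (or_introl eq_refl)), (Hr s (or_intror Hs)).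
      apply cos_inj in Es; [subst; contradiction|lra|lra].
    + apply IH; [exact Hnd'|intros; apply Hr; right; assumption].
  - intros y H; apply in_map_iff in H; destruct H as (r & <- & H).
    destruct (Hr r H) as [_ Z]. rewrite E in Z. simpl in Z; lra.
  - rewrite length_map, HL; lia.
Qed.

(** The pair [(a, b)] stands for the cells [a, ..., b - 1]. Maximality is recorded on the left: the
    good cell [a - 1] supplies the separating point when runs are counted. *)
Definition is_run (bad : nat -> Prop) (I : nat * nat) : Prop :=
  (fst I < snd I)%nat /\ (forall k, (fst I <= k < snd I)%nat -> bad k) /\
  ((0 < fst I)%nat -> ~ bad (fst I - 1)%nat).

(** Scanning the cells upwards, a bad cell either prolongs the latest run, kept at the head of the
    list, or starts a new one. The strict inequality leaves a whole cell between two runs, hence the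
    distance [PI / n] in (e). *)
Lemma runs (bad : nat -> Prop) m :
  exists l : list (nat * nat),
    (forall I, In I l -> is_run bad I /\ (snd I <= m)%nat) /\
    ForallOrdPairs (fun I J => (snd J < fst I)%nat) l /\
    (forall k, (k < m)%nat -> bad k -> exists I, In I l /\ (fst I <= k < snd I)%nat).
Proof.
  induction m as [|m (l & Hl & Hs & Hc)].
  - exists nil; repeat split; try constructor; try contradiction; intros; lia.
  - destruct (classic (bad m)) as [Hb|Hb].
    2:{ exists l; split; [|split; [exact Hs|]].
        - intros I HI; destruct (Hl I HI); split; [assumption|lia].
        - intros k Hk Hbk. destruct (Nat.eq_dec k m) as [->|]; [contradiction|].
          apply Hc; [lia|assumption]. }
    assert (Hnew : (forall I, In I l -> (snd I < m)%nat) ->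
      exists l : list (nat * nat),
      (forall I, In I l -> is_run bad I /\ (snd I <= S m)%nat) /\
      ForallOrdPairs (fun I J => (snd J < fst I)%nat) l /\
      (forall k, (k < S m)%nat -> bad k -> exists I, In I l /\ (fst I <= k < snd I)%nat)).
    { intros Hlt. exists ((m, S m) :: l); split; [|split].
      - intros I [<-|HI].
        + unfold is_run; simpl; split; [split; [lia|split]|lia].
          * intros k Hk; replace k with m by lia; exact Hb.
          * intros Hm Hb'. destruct (Hc (m - 1)%nat ltac:(lia) Hb') as (J & HJ & HJ').
            specialize (Hlt J HJ); lia.
        + destruct (Hl I HI); split; [assumption|lia].
      - constructor; [|exact Hs]. apply Forall_forall; intros J HJ; simpl; auto.
      - intros k Hk Hbk. destruct (Nat.eq_dec k m) as [->|].
        + exists (m, S m); split; [left; reflexivity|simpl; lia].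
        + destruct (Hc k ltac:(lia) Hbk) as (I & HI & HI').
          exists I; split; [right; exact HI|exact HI']. }
    destruct l as [|[a b] l]; [apply Hnew; contradiction|].
    inversion Hs as [|? ? Hf Hs']; subst. rewrite Forall_forall in Hf; simpl in Hf.
    destruct (Hl (a, b) (or_introl eq_refl)) as [(Hab & Hbad & Hst) Hbm]; simpl in *.
    destruct (Nat.eq_dec b m) as [->|Hne].
    2:{ apply Hnew. intros I [<-|HI]; simpl; [lia|]. specialize (Hf I HI); lia. }
    exists ((a, S m) :: l); split; [|split].
    + intros I [<-|HI].
      * unfold is_run; simpl; split; [split; [lia|split; [|exact Hst]]|lia].
        intros k Hk. destruct (Nat.eq_dec k m) as [->|]; [exact Hb|apply Hbad; lia].
      * destruct (Hl I (or_intror HI)); split; [assumption|lia].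
    + constructor; [apply Forall_forall; exact Hf|exact Hs'].
    + intros k Hk Hbk. destruct (Nat.eq_dec k m) as [->|].
      * exists (a, S m); split; [left; reflexivity|simpl; lia].
      * destruct (Hc k ltac:(lia) Hbk) as (I & [<-|HI] & HI').
        -- exists (a, S m); split; [left; reflexivity|simpl in *; lia].
        -- exists I; split; [right; exact HI|exact HI'].
Qed.

(** Used in the variable [x = 2 theta] with [h = 2 PI / n], so that a cell has length [PI / n] in
    [theta]. *)
Definition bad_cell (f : R -> R) (h eta : R) (k : nat) : Prop :=
  exists x, INR k * h <= x <= INR (k + 1) * h /\ Rabs (f x) < eta.

Lemma sq_abs_lt a b : 0 <= b -> Rabs a < b -> a ^ 2 < b ^ 2.
Proof. intros Hb H; apply Rabs_def2 in H; nra. Qed.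

Lemma sq_abs_le a b : 0 <= a -> a <= Rabs b -> a ^ 2 <= b ^ 2.
Proof. intros Ha H; rewrite <- (pow2_abs b); nra. Qed.

(* Between consecutive runs lies the midpoint of a good cell. *)
Lemma runs_alternating f h eta l hi :
  0 < h -> 0 < eta ->
  (forall I, In I l -> is_run (bad_cell f h eta) I /\ (1 <= fst I)%nat /\ INR (snd I) * h < hi) ->
  ForallOrdPairs (fun I J => (snd J < fst I)%nat) l ->
  exists c l', c < eta ^ 2 /\ length l' = length l /\
    forall c', c <= c' < eta ^ 2 -> alternating (fun x => f x ^ 2 - c') 0 hi l'.
Proof.
  intros Hh Heta; revert hi; induction l as [|[a b] l IH]; intros hi Hl Hs.
  - exists 0, nil; split; [nra|split; [reflexivity|]]; intros; exact I.
  - inversion Hs as [|? ? Hf Hs']; subst. rewrite Forall_forall in Hf; simpl in Hf.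
    destruct (Hl (a, b) (or_introl eq_refl)) as ((Hab & Hbad & Hst) & Ha & Hhi); simpl in *.
    destruct (Hbad a ltac:(lia)) as (p & Hp & Fp).
    assert (Ea : INR a = INR (a - 1) + 1) by (rewrite <- S_INR; f_equal; lia).
    set (g := (INR (a - 1) + / 2) * h).
    pose proof (pos_INR (a - 1)) as Pa.
    assert (Fg : eta <= Rabs (f g)).
    { apply Rnot_lt_le; intros Hg. apply Hst; [lia|]. exists g; split; [|exact Hg].
      rewrite plus_INR; unfold g; simpl; split; apply Rmult_le_compat_r; lra. }
    destruct (IH g) as (c & l' & Hc & Hlen & Halt); [| exact Hs' |].
    { intros J HJ. destruct (Hl J (or_intror HJ)) as (R1 & R2 & _).
      split; [exact R1|split; [exact R2|]].
      specialize (Hf J HJ). assert (INR (snd J) <= INR (a - 1)) by (apply le_INR; lia).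
      unfold g; nra. }
    (* Any level from the midpoint of [f p ^ 2] and [eta ^ 2] up to, but excluding, [eta ^ 2]
       separates [p] from [g]. The maximum makes one level serve all runs. *)
    exists (Rmax c (f p ^ 2 + (eta ^ 2 - f p ^ 2) / 2)), ((g, p) :: l').
    pose proof (sq_abs_lt _ _ (Rlt_le _ _ Heta) Fp) as Fp2.
    pose proof (sq_abs_le _ _ (Rlt_le _ _ Heta) Fg) as Fg2.
    split; [apply Rmax_lub_lt; lra|split; [simpl; lia|]].
    intros c' Hc'. pose proof (Rmax_l c (f p ^ 2 + (eta ^ 2 - f p ^ 2) / 2)).
    pose proof (Rmax_r c (f p ^ 2 + (eta ^ 2 - f p ^ 2) / 2)).
    cbn [alternating]. refine (conj _ (conj _ (conj _ (conj _ _)))); [|split| | |].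
    + unfold g; nra.
    + assert (g < INR a * h) by (unfold g; nra). lra.
    + assert (INR (a + 1) <= INR b) by (apply le_INR; lia). nra.
    + lra.
    + lra.
    + apply Halt; lra.
Qed.

Lemma run_count f T d h eta hi l :
  poly_fun d T -> (forall x, f x = T (cos x)) -> continuity f ->
  0 < h -> 0 < eta -> hi <= PI -> eta <= Rabs (f hi) ->
  (forall I, In I l -> is_run (bad_cell f h eta) I /\ (1 <= fst I)%nat /\ INR (snd I) * h < hi) ->
  ForallOrdPairs (fun I J => (snd J < fst I)%nat) l ->
  (length l <= d)%nat.
Proof.
  intros HT E Hf Hh Heta Hhi Fhi Hl Hs.
  destruct (runs_alternating f h eta l hi Hh Heta Hl Hs) as (c & l' & Hc & <- & Halt).
  pose proof (sq_abs_le _ _ (Rlt_le _ _ Heta) Fhi).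
  apply (alternating_count f T d c 0 hi); auto; try lra. apply Halt; lra.
Qed.

(** * Arcs *)

Lemma arc_shift n I J m theta theta' :
  (0 < n)%nat ->
  fst J = (fst I + m * Z.of_nat n)%Z -> snd J = (snd I + m * Z.of_nat n)%Z ->
  (exists k, theta' = theta + IZR m * PI + 2 * PI * IZR k) ->
  arc n I theta -> arc n J theta'.
Proof.
  intros Hn E1 E2 [k0 ->] [k Hk]. apply lt_0_INR in Hn. exists (k - k0)%Z.
  rewrite E1, E2, !plus_IZR, mult_IZR, minus_IZR, <- INR_IZR_INZ.
  replace ((IZR (fst I) + IZR m * INR n) * PI / INR n)
    with (IZR (fst I) * PI / INR n + IZR m * PI) by (field; lra).
  replace ((IZR (snd I) + IZR m * INR n) * PI / INR n)
    with (IZR (snd I) * PI / INR n + IZR m * PI) by (field; lra).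
  lra.
Qed.

Lemma arc_reflect n I J m theta theta' :
  (0 < n)%nat ->
  fst J = (m * Z.of_nat n - snd I)%Z -> snd J = (m * Z.of_nat n - fst I)%Z ->
  (exists k, theta' = IZR m * PI - theta + 2 * PI * IZR k) ->
  arc n I theta -> arc n J theta'.
Proof.
  intros Hn E1 E2 [k0 ->] [k Hk]. apply lt_0_INR in Hn. exists (- k - k0)%Z.
  rewrite E1, E2, !minus_IZR, opp_IZR, mult_IZR, <- INR_IZR_INZ.
  replace ((IZR m * INR n - IZR (fst I)) * PI / INR n)
    with (IZR m * PI - IZR (fst I) * PI / INR n) by (field; lra).
  replace ((IZR m * INR n - IZR (snd I)) * PI / INR n)
    with (IZR m * PI - IZR (snd I) * PI / INR n) by (field; lra).
  lra.
Qed.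

Lemma arc_half_turn n I J s theta :
  (0 < n)%nat -> (s = 1 \/ s = -1)%Z ->
  fst J = (fst I + s * Z.of_nat n)%Z -> snd J = (snd I + s * Z.of_nat n)%Z ->
  (arc n J theta <-> arc n I (theta - PI)).
Proof.
  intros Hn Hs E1 E2; split.
  - apply arc_shift with (m := (- s)%Z); auto; try lia.
    destruct Hs as [->| ->]; [exists 0%Z|exists (-1)%Z]; simpl; ring.
  - apply arc_shift with (m := s); auto.
    destruct Hs as [->| ->]; [exists 0%Z|exists 1%Z]; simpl; ring.
Qed.

Lemma arc_mirror n I J k theta :
  (0 < n)%nat ->
  fst J = ((1 + 2 * k) * Z.of_nat n - snd I)%Z ->
  snd J = ((1 + 2 * k) * Z.of_nat n - fst I)%Z ->
  (arc n J theta <-> arc n I (PI - theta)).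
Proof.
  intros Hn E1 E2; split; apply arc_reflect with (m := (1 + 2 * k)%Z); auto; try lia;
    exists (- k)%Z; rewrite plus_IZR, mult_IZR, opp_IZR; ring.
Qed.

Definition sep (I J : Z * Z) : Prop := (snd I < fst J)%Z \/ (snd J < fst I)%Z.

(** Staying away from the cut point [0 = 2n] lets separation modulo [2n] be read off by comparing
    integer endpoints. *)
Definition inner (n : nat) (I : Z * Z) : Prop :=
  (104 <= fst I)%Z /\ (fst I < snd I)%Z /\ (snd I + 104 <= 2 * Z.of_nat n)%Z.

Lemma sep_arc_dist n I J :
  (0 < n)%nat -> inner n I -> inner n J -> sep I J -> arc_dist_ge n I J (PI / INR n).
Proof.
  intros Hn HI HJ Hs th th' [k1 H1] [k2 H2] k. apply lt_0_INR in Hn.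
  set (w := PI / INR n) in *.
  assert (Hw : 0 < w) by (apply Rdiv_lt_0_compat; [apply PI_RGT_0|lra]).
  assert (EP : PI = INR n * w) by (unfold w; field; lra).
  replace (IZR (fst I) * PI / INR n) with (IZR (fst I) * w) in H1 by (unfold w; field; lra).
  replace (IZR (snd I) * PI / INR n) with (IZR (snd I) * w) in H1 by (unfold w; field; lra).
  replace (IZR (fst J) * PI / INR n) with (IZR (fst J) * w) in H2 by (unfold w; field; lra).
  replace (IZR (snd J) * PI / INR n) with (IZR (snd J) * w) in H2 by (unfold w; field; lra).
  rewrite EP, INR_IZR_INZ in *. clear EP.
  set (m := (k1 - k2 + k)%Z).
  assert (Hm :
    th - th' - 2 * (IZR (Z.of_nat n) * w) * IZR k
    = (th + 2 * (IZR (Z.of_nat n) * w) * IZR k1)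
      - (th' + 2 * (IZR (Z.of_nat n) * w) * IZR k2) - IZR (2 * Z.of_nat n * m) * w).
  { unfold m; rewrite !mult_IZR, plus_IZR, minus_IZR; ring. }
  rewrite Hm; clear Hm.
  set (u := th + _) in *; set (v := th' + _) in *.
  set (q := (2 * Z.of_nat n * m)%Z).
  (* Without a relative full turn this is [sep]; with one, the margins at [0] and [2n] suffice. *)
  assert (C : (fst I - snd J - q >= 1)%Z \/ (snd I - fst J - q <= -1)%Z).
  { unfold inner, sep in *; subst q.
    destruct (Z.lt_trichotomy m 0) as [H|[H|H]].
    - left; nia.
    - rewrite H; lia.
    - right; nia. }
  destruct C as [C|C].
  - eapply Rle_trans; [|apply Rle_abs].
    assert (IZR 1 <= IZR (fst I - snd J - q)) by (apply IZR_le; lia).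
    rewrite !minus_IZR in *. nra.
  - rewrite <- Rabs_Ropp; eapply Rle_trans; [|apply Rle_abs].
    assert (IZR (snd I - fst J - q) <= IZR (-1)) by (apply IZR_le; lia).
    rewrite !minus_IZR in *. nra.
Qed.

(* The constant 208 is twice 104, a margin that beats the 100 of condition (f). *)
Definition in_quadrant (n : nat) (q : Z) (I : Z * Z) : Prop :=
  (q * Z.of_nat n + 208 <= 2 * fst I)%Z /\ (fst I < snd I)%Z /\
  (2 * snd I + 208 <= (q + 1) * Z.of_nat n)%Z.

Lemma in_quadrant_far n q I theta m y :
  (0 < n)%nat -> in_quadrant n q I -> arc n I theta ->
  Rabs y <= 100 * PI / INR n -> theta <> IZR m * (PI / 2) + y.
Proof.
  intros Hn (Q1 & Q2 & Q3) [k Hk] Hy ->. apply lt_0_INR in Hn.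
  set (w := PI / INR n) in *.
  assert (Hw : 0 < w) by (apply Rdiv_lt_0_compat; [apply PI_RGT_0|lra]).
  assert (EP : PI = INR n * w) by (unfold w; field; lra).
  replace (IZR (fst I) * PI / INR n) with (IZR (fst I) * w) in Hk by (unfold w; field; lra).
  replace (IZR (snd I) * PI / INR n) with (IZR (snd I) * w) in Hk by (unfold w; field; lra).
  replace (100 * PI / INR n) with (100 * w) in Hy by (unfold w; field; lra).
  rewrite EP, INR_IZR_INZ in *. clear EP.
  apply Rabs_le_bounds in Hy.
  set (p := ((m + 4 * k) * Z.of_nat n)%Z).
  replace (IZR m * (IZR (Z.of_nat n) * w / 2) + y + 2 * (IZR (Z.of_nat n) * w) * IZR k)
    with (IZR p * w / 2 + y) in Hk
    by (unfold p; rewrite mult_IZR, plus_IZR, mult_IZR; field).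
  (* The integer [p] is the multiple of [PI / 2] in units of [PI / (2n)]. No multiple of [n] lies
     strictly between [q n] and [(q + 1) n], so it is at least 104 steps [PI / n] from the arc. *)
  assert (C : (p <= 2 * fst I - 208)%Z \/ (2 * snd I + 208 <= p)%Z).
  { subst p. destruct (Z_le_gt_dec (m + 4 * k) q); [left|right]; nia. }
  destruct C as [C|C]; apply IZR_le in C;
    rewrite ?minus_IZR, ?plus_IZR, mult_IZR in C; nra.
Qed.

(* The images of [[a, b]], in units of [pi/n], under [theta], [pi - theta], [pi + theta] and
   [- theta], taken in [[0, 2n]]. *)
Definition copy (n : nat) (q : nat) (I : nat * nat) : Z * Z :=
  let a := Z.of_nat (fst I) in let b := Z.of_nat (snd I) in let N := Z.of_nat n in
  match q with
  | 0%nat => (a, b)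
  | 1%nat => (N - b, N - a)
  | 2%nat => (N + a, N + b)
  | _ => (2 * N - b, 2 * N - a)
  end%Z.

Definition copies (n : nat) (l : list (nat * nat)) : list (Z * Z) :=
  map (copy n 0) l ++ map (copy n 1) l ++ map (copy n 2) l ++ map (copy n 3) l.

Lemma in_copies n l I :
  In I (copies n l) <-> exists q J, (q < 4)%nat /\ In J l /\ I = copy n q J.
Proof.
  unfold copies; rewrite !in_app_iff, !in_map_iff; split.
  - intros [(J & <- & H)|[(J & <- & H)|[(J & <- & H)|(J & <- & H)]]];
      [exists 0%nat|exists 1%nat|exists 2%nat|exists 3%nat]; exists J; repeat split; auto; lia.
  - intros (q & J & Hq & H & ->). destruct q as [|[|[|[|q]]]]; try lia;
      [left|right; left|do 2 right; left|do 3 right]; exists J; auto.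
Qed.

Lemma ForallOrdPairs_app {A} (P : A -> A -> Prop) l1 l2 :
  ForallOrdPairs P l1 -> ForallOrdPairs P l2 ->
  (forall x y, In x l1 -> In y l2 -> P x y) -> ForallOrdPairs P (l1 ++ l2).
Proof.
  intros H1 H2; induction H1 as [|x l1 Hx H1 IH]; intros H; [exact H2|].
  simpl; constructor.
  - apply Forall_app; split; [exact Hx|].
    apply Forall_forall; intros y Hy; apply H; [left; reflexivity|exact Hy].
  - apply IH; intros; apply H; [right|]; assumption.
Qed.

Lemma ForallOrdPairs_map {A B} (f : A -> B) (P : A -> A -> Prop) (Q : B -> B -> Prop) l :
  (forall x y, P x y -> Q (f x) (f y)) -> ForallOrdPairs P l -> ForallOrdPairs Q (map f l).
Proof.
  intros H; induction 1 as [|x l Hx _ IH]; simpl; constructor; [|exact IH].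
  apply Forall_map; eapply Forall_impl; [|exact Hx]; auto.
Qed.

Lemma ForallOrdPairs_nth {A} (P : A -> A -> Prop) l d i j :
  ForallOrdPairs P l -> (i < j < length l)%nat -> P (nth i l d) (nth j l d).
Proof.
  intros H; revert i j; induction H as [|x l Hx _ IH]; intros i j Hij; simpl in Hij; [lia|].
  destruct j as [|j]; [lia|]. destruct i as [|i]; simpl.
  - rewrite Forall_forall in Hx; apply Hx, nth_In; lia.
  - apply IH; lia.
Qed.

Definition quarter_run (n : nat) (I : nat * nat) : Prop :=
  (104 <= fst I)%nat /\ (fst I < snd I <= fst I + 6)%nat /\ (2 * snd I + 208 <= n)%nat.

Lemma copy_quadrant n q I :
  (q < 4)%nat -> quarter_run n I -> in_quadrant n (Z.of_nat q) (copy n q I).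
Proof.
  unfold in_quadrant, quarter_run; intros Hq H.
  destruct q as [|[|[|[|q]]]]; try lia; unfold copy; cbn [fst snd]; lia.
Qed.

Lemma copies_sep n l :
  (forall I, In I l -> quarter_run n I) ->
  ForallOrdPairs (fun I J => (snd J < fst I)%nat) l -> ForallOrdPairs sep (copies n l).
Proof.
  intros Hl Hs.
  assert (S1 : forall q, ForallOrdPairs sep (map (copy n q) l)).
  { intros q; eapply ForallOrdPairs_map; [|exact Hs].
    intros I J H; cbv beta in H; unfold sep; destruct q as [|[|[|q]]]; unfold copy; cbn [fst snd]; lia. }
  (* Copies in different quadrants are separated by a quadrant boundary, with margins on both
     sides. *)
  assert (S2 : forall p q x y, (p < q < 4)%nat -> In x (map (copy n p) l) ->
    In y (map (copy n q) l) -> sep x y).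
  { intros p q x y Hpq Hx Hy. apply in_map_iff in Hx, Hy.
    destruct Hx as (I & <- & HI), Hy as (J & <- & HJ). left.
    destruct (copy_quadrant n p I ltac:(lia) (Hl I HI)) as (_ & _ & H1).
    destruct (copy_quadrant n q J ltac:(lia) (Hl J HJ)) as (H2 & _ & _). nia. }
  unfold copies. repeat apply ForallOrdPairs_app; auto; intros x y Hx Hy;
    rewrite ?in_app_iff in Hy; repeat destruct Hy as [Hy|Hy];
    match type of Hx with In _ (map (copy n ?p) _) =>
      match type of Hy with In _ (map (copy n ?q) _) => apply (S2 p q); auto; lia end end.
Qed.

Lemma copies_well_separated n g l :
  (0 < n)%nat -> (forall I, In I l -> quarter_run n I) ->
  ForallOrdPairs (fun I J => (snd J < fst I)%nat) l -> INR (length l) <= g * INR n ->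
  well_separated n g (copies n l).
Proof.
  intros Hn Hl Hs Hg.
  pose proof (copies_sep n l Hl Hs) as HS.
  assert (HQ : forall I, In I (copies n l) -> exists q, (0 <= q < 4)%Z /\ in_quadrant n q I).
  { intros I H; apply in_copies in H; destruct H as (q & J & Hq & HJ & ->).
    exists (Z.of_nat q); split; [lia|]; apply copy_quadrant; auto. }
  assert (HI : forall I, In I (copies n l) -> inner n I).
  { intros I H; destruct (HQ I H) as (q & Hq & Q1 & Q2 & Q3); unfold inner; nia. }
  assert (HL : forall I, In I (copies n l) -> (snd I - fst I <= 6)%Z).
  { intros I H; apply in_copies in H; destruct H as (q & J & Hq & HJ & ->).
    apply Hl in HJ; unfold quarter_run in HJ; destruct q as [|[|[|q]]]; unfold copy; cbn [fst snd]; lia. }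
  assert (HD : forall i j, (i < length (copies n l))%nat -> (j < length (copies n l))%nat ->
    i <> j -> arc_dist_ge n (nth i (copies n l) (0, 0)%Z) (nth j (copies n l) (0, 0)%Z)
                (PI / INR n)).
  { intros i j Hi Hj Hij. apply sep_arc_dist; [exact Hn|apply HI, nth_In, Hi|apply HI, nth_In, Hj|].
    destruct (Nat.lt_total i j) as [H|[H|H]]; [|contradiction|].
    - apply ForallOrdPairs_nth; [exact HS|lia].
    - destruct (ForallOrdPairs_nth _ _ (0, 0)%Z j i HS ltac:(lia)); [right|left]; assumption. }
  assert (HN : 0 < INR n) by (apply lt_0_INR; exact Hn).
  split; [split; [|split; [|split; [|split]]]|split; [|split]].
  - intros I H; destruct (HI I H) as (? & ? & ?); specialize (HL I H); unfold proper_arc; lia.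
  - intros i j Hij th [H1 H2].
    specialize (HD i j ltac:(lia) ltac:(lia) ltac:(lia) th th H1 H2 0%Z).
    replace (th - th - 2 * PI * 0) with 0 in HD by ring. rewrite Rabs_R0 in HD.
    pose proof (Rdiv_lt_0_compat _ _ PI_RGT_0 HN); lra.
  - intros I H; apply in_copies in H; destruct H as (q & J & Hq & HJ & ->).
    exists (copy n ((q + 2) mod 4) J); split.
    { apply in_copies; exists ((q + 2) mod 4)%nat, J; split; [apply Nat.mod_upper_bound; lia|auto]. }
    intros th; destruct q as [|[|[|[|q]]]]; try lia;
      [ apply (arc_half_turn _ _ _ 1) | apply (arc_half_turn _ _ _ 1)
      | apply (arc_half_turn _ _ _ (-1)) | apply (arc_half_turn _ _ _ (-1)) ];
      auto; unfold copy; cbn [fst snd Nat.add Nat.modulo Nat.divmod Nat.sub]; lia.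
  - intros I H; apply in_copies in H; destruct H as (q & J & Hq & HJ & ->).
    (* The reflection [PI - theta] exchanges the first two quadrants and the last two. *)
    set (p := match q with 0 => 1 | 1 => 0 | 2 => 3 | _ => 2 end%nat).
    exists (copy n p J); split.
    { apply in_copies; exists p, J; split; [|auto]; destruct q as [|[|[|]]]; simpl in *; lia. }
    intros th; destruct q as [|[|[|[|q]]]]; try lia;
      [ apply (arc_mirror _ _ _ 0) | apply (arc_mirror _ _ _ 0)
      | apply (arc_mirror _ _ _ 1) | apply (arc_mirror _ _ _ 1) ];
      auto; unfold p, copy; cbn [fst snd]; lia.
  - exists (length l); split; [|exact Hg].
    unfold copies; rewrite !length_app, !length_map; lia.
  - exact HL.
  - exact HD.
  - intros I H th Hth m y Hy. destruct (HQ I H) as (q & _ & Q).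
    exact (in_quadrant_far n q I th m y Hn Q Hth Hy).
Qed.

(** * Constants and conclusion *)

(** The frequency is [k = 2m]: the lower block of [m] reads its sign from [P_t], the upper one from
    [Q_t]. On [Cset t] the default 0 of [nth] is never reached. *)
Definition RS_sign (t k : nat) : R :=
  let m := (k / 2)%nat in
  if (m <? 2 ^ (t + 11))%nat then nth (m - 2 ^ (t + 10)) (RSP t) 0
  else nth (m - 2 ^ (t + 11)) (RSQ t) 0.

Lemma RS_sign_P t i :
  (i < 2 ^ t)%nat -> RS_sign t (2 * (2 ^ (t + 10) + i)) = nth i (RSP t) 0.
Proof.
  intros Hi; unfold RS_sign. rewrite (Nat.mul_comm 2), Nat.div_mul by lia.
  replace (2 ^ (t + 10) + i - 2 ^ (t + 10))%nat with i by lia.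
  destruct (Nat.ltb_spec (2 ^ (t + 10) + i) (2 ^ (t + 11))) as [|H]; [reflexivity|exfalso].
  rewrite !Nat.pow_add_r in H; simpl in H; lia.
Qed.

Lemma RS_sign_Q t i : RS_sign t (2 * (2 ^ (t + 11) + i)) = nth i (RSQ t) 0.
Proof.
  unfold RS_sign. rewrite (Nat.mul_comm 2), Nat.div_mul by lia.
  replace (2 ^ (t + 11) + i - 2 ^ (t + 11))%nat with i by lia.
  destruct (Nat.ltb_spec (2 ^ (t + 11) + i) (2 ^ (t + 11))) as [H|]; [lia|reflexivity].
Qed.

Lemma RS_sign_pm1 t k : In k (Cset t) -> RS_sign t k = 1 \/ RS_sign t k = -1.
Proof.
  unfold Cset; intros H; apply in_map_iff in H; destruct H as (m & <- & H).
  destruct (RS_length t) as [LP LQ], (RS_signs t) as [SP SQ]. rewrite Forall_forall in SP, SQ.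
  apply in_app_iff in H; destruct H as [H|H]; apply in_seq in H.
  - replace m with (2 ^ (t + 10) + (m - 2 ^ (t + 10)))%nat by lia.
    rewrite RS_sign_P by lia. apply SP, nth_In; lia.
  - replace m with (2 ^ (t + 11) + (m - 2 ^ (t + 11)))%nat by lia.
    rewrite RS_sign_Q by lia. apply SQ, nth_In; lia.
Qed.

(** A general [acc] lets the sums over the two blocks be chained. *)
Lemma fold_right_csum eps theta L s acc :
  (forall i, (i < length L)%nat -> eps (2 * (s + i))%nat = nth i L 0) ->
  fold_right (fun k acc => eps k * cos (INR k * theta) + acc) acc
    (map (fun m => (2 * m)%nat) (seq s (length L))) = csum 0 (INR s) L (2 * theta) + acc.
Proof.
  revert s; induction L as [|e L IH]; intros s H; cbn [length seq map fold_right csum]; [ring|].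
  rewrite IH, S_INR.
  - pose proof (H 0%nat ltac:(simpl; lia)) as H0; rewrite Nat.add_0_r in H0; rewrite H0.
    rewrite mult_INR; simpl (INR 2); cbn [nth].
    replace ((1 + 1) * INR s * theta) with (INR s * (2 * theta)) by ring. simpl; ring.
  - intros i Hi. specialize (H (S i) ltac:(simpl; lia)); cbn [nth] in H.
    rewrite <- H; f_equal; lia.
Qed.

Lemma cpoly_RSF t theta : cpoly t (RS_sign t) theta = RSF 0 t (2 * theta).
Proof.
  destruct (RS_length t) as [LP LQ].
  unfold cpoly, Cset; rewrite map_app, fold_right_app.
  pose proof (fun acc => fold_right_csum (RS_sign t) theta (RSP t) (2 ^ (t + 10)) acc
    ltac:(intros; apply RS_sign_P; lia)) as EP.
  pose proof (fold_right_csum (RS_sign t) theta (RSQ t) (2 ^ (t + 11)) 0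
    ltac:(intros; apply RS_sign_Q)) as EQ.
  rewrite LP in EP; rewrite LQ in EQ. rewrite EQ, EP, !INR_pow2, Rplus_0_r; reflexivity.
Qed.

Lemma gam_mul n t : (0 < n)%nat -> gam n t * INR n = 2 ^ (t + 11) + 2 ^ t - 1.
Proof. intros Hn; apply lt_0_INR in Hn; unfold gam; field; lra. Qed.

Lemma freq_bounds t :
  2048 * 2 ^ t <= 2 ^ (t + 11) + 2 ^ t - 1 <= 2049 * 2 ^ t /\ 2 ^ (t + 10) = 1024 * 2 ^ t /\ 1 <= 2 ^ t.
Proof.
  assert (1 <= 2 ^ t) by (apply pow_R1_Rle; lra).
  rewrite !pow_add; simpl (2 ^ 11); simpl (2 ^ 10); lra.
Qed.

(** Up to a factor between 2048/2049 and 1, [2 A] is [gam n t * INR n], so the product is nearly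
    [PI * gam n t]; the constants follow from [3 <= PI <= 4]. *)
Lemma step_bounds n t :
  (0 < n)%nat -> 0 < gam n t ->
  29 / 10 * gam n t <= 2 * PI / INR n * 2 ^ (t + 10) <= 4 * gam n t.
Proof.
  intros Hn Hg. pose proof (gam_mul n t Hn) as Hgn.
  apply lt_0_INR in Hn.
  destruct (freq_bounds t) as (Hd & HA & H1). set (g := gam n t) in *.
  set (k := 2 * PI / INR n * 2 ^ (t + 10)).
  assert (E : k * (2 ^ (t + 11) + 2 ^ t - 1) = 2 * PI * g * (1024 * 2 ^ t)).
  { rewrite <- Hgn; unfold k; rewrite HA; field; lra. }
  set (d := 2 ^ (t + 11) + 2 ^ t - 1) in *. set (N := 2 ^ t) in *.
  pose proof PI2_3_2. pose proof PI_4.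
  assert (HgN : 0 < g * N) by (apply Rmult_lt_0_compat; lra).
  assert (Hlo : 3 * (g * N) <= PI * (g * N)) by (apply Rmult_le_compat_r; lra).
  assert (Hhi : PI * (g * N) <= 4 * (g * N)) by (apply Rmult_le_compat_r; lra).
  split; apply Rmult_le_reg_r with d; try lra; rewrite E; nra.
Qed.

(** One has [delta sqrt n = gamma^3 sqrt(gamma n) / 256], and
    [gamma n <= 2049 * 2^t <= 33^2 * 2^(t+1)]. *)
Lemma del_bounds n t :
  (0 < n)%nat -> 0 < gam n t ->
  0 < del n t * sqrt (INR n) <= 33 / 256 * (gam n t ^ 3 * amp t).
Proof.
  intros Hn Hg. pose proof (gam_mul n t Hn) as Hgn. apply lt_0_INR in Hn.
  destruct (freq_bounds t) as (Hd & HA & H1).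
  unfold del. set (g := gam n t) in *.
  replace (7 / 2) with (INR 3 + / 2) by (simpl; lra).
  rewrite Rpower_plus, Rpower_pow, Rpower_sqrt by assumption.
  replace (g ^ 3 * sqrt g / 2 ^ 8 * sqrt (INR n)) with (g ^ 3 * (sqrt g * sqrt (INR n)) / 256)
    by (simpl; field).
  rewrite <- sqrt_mult, Hgn by lra.
  assert (Hg3 : 0 < g ^ 3) by (apply pow_lt; exact Hg).
  assert (Hs : 0 < sqrt (2 ^ (t + 11) + 2 ^ t - 1) <= 33 * amp t).
  { split; [apply sqrt_lt_R0; lra|].
    pose proof (amp_pos t). rewrite <- (sqrt_pow2 (33 * amp t)) by lra.
    apply sqrt_le_1_alt. rewrite Rpow_mult_distr, amp_sq; simpl; lra. }
  split; [|nra]. apply Rdiv_lt_0_compat; [|lra]. apply Rmult_lt_0_compat; lra.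
Qed.

Lemma nat_floor x : 0 <= x -> exists k : nat, INR k <= x < INR (k + 1).
Proof.
  intros Hx. destruct (archimed x) as [H1 H2].
  assert (0 < up x)%Z by (apply lt_IZR; lra).
  exists (Z.to_nat (up x - 1)).
  rewrite plus_INR, INR_IZR_INZ, Z2Nat.id, minus_IZR by lia; simpl; lra.
Qed.

(** Since [RSF 0 t (2 theta)] is even and [PI]-periodic in [theta], its values on [[0, PI/2]]
    determine it. *)
Lemma fold_angle theta :
  exists theta0 (m : Z), 0 <= theta0 <= PI / 2 /\
    (theta = theta0 + IZR m * PI \/ theta = - theta0 + IZR m * PI).
Proof.
  pose proof PI_RGT_0 as HP.
  destruct (archimed (theta / PI)) as [H1 H2].
  set (z := up (theta / PI)) in *.
  assert (E : theta = theta / PI * PI) by (field; lra).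
  set (q := theta / PI) in *.
  destruct (Rle_dec (theta - IZR (z - 1) * PI) (PI / 2)) as [H|H].
  - exists (theta - IZR (z - 1) * PI), (z - 1)%Z.
    rewrite minus_IZR in *. split; [split; nra|left; ring].
  - exists (IZR z * PI - theta), z.
    rewrite minus_IZR in *. split; [split; nra|right; ring].
Qed.

(** The parity of [m] and the sign of [theta0] select one of the four copies. *)
Lemma arc_copies n l I theta theta0 m :
  (0 < n)%nat -> In I l ->
  INR (fst I) * (PI / INR n) <= theta0 <= INR (snd I) * (PI / INR n) ->
  theta = theta0 + IZR m * PI \/ theta = - theta0 + IZR m * PI ->
  exists J, In J (copies n l) /\ arc n J theta.
Proof.
  intros Hn HI H0 Hth.
  assert (A0 : arc n (copy n 0 I) theta0).
  { exists 0%Z; unfold copy; cbn [fst snd]; rewrite <- !INR_IZR_INZ.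
    unfold Rdiv in *; lra. }
  assert (C : forall q, (q < 4)%nat -> In (copy n q I) (copies n l))
    by (intros; apply in_copies; eauto).
  destruct (Z.Even_or_Odd m) as [[k ->]|[k ->]];
    rewrite ?plus_IZR, mult_IZR in Hth; destruct Hth as [->| ->].
  - exists (copy n 0 I); split; [apply C; lia|].
    apply (arc_shift n (copy n 0 I) _ 0 theta0); auto; try lia. exists k; simpl; ring.
  - exists (copy n 3 I); split; [apply C; lia|].
    apply (arc_reflect n (copy n 0 I) _ 2 theta0); auto. exists (k - 1)%Z.
    rewrite minus_IZR; simpl; ring.
  - exists (copy n 2 I); split; [apply C; lia|].
    apply (arc_shift n (copy n 0 I) _ 1 theta0); auto; unfold copy; cbn [fst snd]; try lia.
    exists k; simpl; ring.
  - exists (copy n 1 I); split; [apply C; lia|].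
    apply (arc_reflect n (copy n 0 I) _ 1 theta0); auto; unfold copy; cbn [fst snd]; try lia.
    exists k; simpl; ring.
Qed.

Theorem theorem2p3 :
  exists N0 : nat, forall n t : nat, (N0 <= n)%nat -> (0 < n)%nat ->
    Nat.Odd t ->
    / 2 ^ 43 < gam n t <= / 2 ^ 40 ->
    exists (eps : nat -> R) (l : list (Z * Z)),
      (forall k, In k (Cset t) -> eps k = 1 \/ eps k = -1) /\
      well_separated n (gam n t) l /\
      (forall theta, (forall I, In I l -> ~ arc n I theta) ->
         del n t * sqrt (INR n) <= Rabs (cpoly t eps theta)) /\
      (forall theta, Rabs (cpoly t eps theta) <= sqrt (INR n)).
Proof.
  exists 0%nat; intros n t _ Hn Hodd Hg.
  assert (Hg0 : 0 < gam n t) by (pose proof (Rinv_0_lt_compat (2 ^ 43)); lra).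
  (* With [h A <= 4 gamma] this gives the hypothesis [h A <= / 10000] of the local lemmas. *)
  assert (Hg1 : gam n t <= / 40000) by (eapply Rle_trans; [apply Hg|simpl; lra]).
  clear Hg.
  destruct (step_bounds n t Hn Hg0) as [Hk1 Hk2].
  destruct (del_bounds n t Hn Hg0) as [He0 He1].
  pose proof (gam_mul n t Hn) as Hgn.
  destruct (freq_bounds t) as (Hd & HA & HN1).
  pose proof (amp_pos t) as HR. pose proof PI_RGT_0 as HPI.
  assert (HnR : 0 < INR n) by (apply lt_0_INR; exact Hn).
  set (eta := del n t * sqrt (INR n)) in *. set (g := gam n t) in *.
  set (h := 2 * PI / INR n) in *.
  assert (Hh : 0 < h) by (apply Rdiv_lt_0_compat; lra).
  assert (Hhn : INR n * h = 2 * PI) by (unfold h; field; lra).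
  assert (Hg3 : g ^ 3 <= 1) by (rewrite <- (pow1 3); apply pow_incr; lra).
  (* Numerically, [33/256 < 2.9^3 / 160]. *)
  assert (Hek : eta <= (h * 2 ^ (t + 10)) ^ 3 * amp t / 160).
  { assert (G : (29 / 10 * g) ^ 3 <= (h * 2 ^ (t + 10)) ^ 3) by (apply pow_incr; lra).
    rewrite Rpow_mult_distr in G.
    apply Rmult_le_compat_r with (r := amp t) in G; [|lra].
    pose proof (pow_lt _ 3 Hg0). assert (0 < g ^ 3 * amp t) by (apply Rmult_lt_0_compat; lra).
    lra. }
  assert (Hk : h * 2 ^ (t + 10) <= / 10000) by lra.
  assert (HeR : eta <= amp t / 2).
  { assert (g ^ 3 * amp t <= 1 * amp t) by (apply Rmult_le_compat_r; lra). lra. }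
  set (f := RSF 0 t) in *.
  assert (Hfar : forall x x0, f x0 = amp t -> Rabs (f x) < eta -> 110 * h < Rabs (x - x0)).
  { intros x x0 E Hx. apply Rnot_le_lt; intros H.
    pose proof (RSF_near t h x x0 E Hh Hk H). unfold f in *; lra. }
  pose proof (RSF_0 t Hodd) as F0. pose proof (RSF_PI t Hodd) as FP.
  set (bad := bad_cell f h eta).
  (* A bad point is further than [110 h] from [0] and [PI]. Passing to the left end of its cell
     costs one step near [0]. *)
  assert (Hbad : forall k, (2 * k <= n)%nat -> bad k -> (109 <= k)%nat /\ (2 * k + 220 <= n)%nat).
  { intros k Hkn (x & [Hx1 Hx2] & Hx). rewrite plus_INR in Hx2; simpl in Hx2.
    pose proof (Hfar x 0 F0 Hx) as X0. pose proof (Hfar x PI FP Hx) as X1.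
    rewrite Rminus_0_r in X0.
    pose proof (pos_INR k).
    assert (0 <= x) by nra.
    rewrite Rabs_right in X0 by lra.
    assert (Hkn' : INR (2 * k) <= INR n) by (apply le_INR; exact Hkn).
    rewrite mult_INR in Hkn'; simpl in Hkn'.
    assert (Hxp : x <= PI + h) by nra.
    assert (x < PI - 110 * h).
    { destruct (Rle_dec PI x); [rewrite Rabs_right in X1 by lra; lra|].
      rewrite Rabs_left in X1 by lra; lra. }
    split.
    - apply Nat.lt_le_incl, INR_lt. replace (INR 109) with 109 by (simpl; lra).
      apply Rmult_lt_reg_r with h; lra.
    - apply Nat.lt_le_incl, INR_lt. rewrite plus_INR, mult_INR.
      replace (INR 220) with 220 by (simpl; lra). simpl (INR 2).
      apply Rmult_lt_reg_r with h; lra. }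
  (* The extra cell includes the index [n / 2], so that all of [[0, PI]] in [x] is covered. *)
  destruct (runs bad (n / 2 + 1)) as (l & Hl & Hs & Hc).
  assert (Hn2 : (2 * (n / 2) <= n)%nat) by (apply Nat.Div0.mul_div_le).
  assert (Hl' : forall I, In I l ->
    (109 <= fst I)%nat /\ (2 * snd I + 218 <= n)%nat /\ is_run bad I).
  { intros I HI. destruct (Hl I HI) as [Hr Hm]. destruct Hr as (H1 & H2 & H3).
    destruct (Hbad (fst I) ltac:(lia) (H2 (fst I) ltac:(lia))).
    destruct (Hbad (snd I - 1)%nat ltac:(lia) (H2 (snd I - 1)%nat ltac:(lia))).
    split; [|split; [|split; [|split]]]; auto; lia. }
  assert (Hq : forall I, In I l -> quarter_run n I).
  { intros [a b] HI. destruct (Hl' _ HI) as (H1 & H2 & H3 & H4 & H5); simpl in *.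
    unfold quarter_run; simpl. split; [lia|split; [split; [lia|]|lia]].
    destruct (Nat.le_gt_cases b (a + 6)) as [|Hlong]; [assumption|exfalso].
    (* Every other cell among seven consecutive ones: the skipped cells keep the four points [h]
       apart, within a total length [7 h]. *)
    destruct (H4 a ltac:(lia)) as (x0 & X0 & Y0).
    destruct (H4 (a + 2)%nat ltac:(lia)) as (x1 & X1 & Y1).
    destruct (H4 (a + 4)%nat ltac:(lia)) as (x2 & X2 & Y2).
    destruct (H4 (a + 6)%nat ltac:(lia)) as (x3 & X3 & Y3).
    rewrite ?plus_INR in X0; rewrite ?plus_INR in X1; rewrite ?plus_INR in X2;
      rewrite ?plus_INR in X3; simpl in X0, X1, X2, X3.
    apply (RSF_four_small t h eta x0 x1 x2 x3); [lra|exact Hk|exact Hek|lra|lra|lra|lra|left; assumption..]. }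
  assert (Hcount : INR (length l) <= g * INR n).
  { destruct (RSF_poly t) as (T & HT & ET).
    rewrite Hgn.
    replace (2 ^ (t + 11) + 2 ^ t - 1) with (INR (2 ^ (t + 11) + 2 ^ t - 1)).
    2:{ assert (0 < 2 ^ t)%nat by (apply Nat.neq_0_lt_0, Nat.pow_nonzero; lia).
        rewrite minus_INR, plus_INR, !INR_pow2 by lia; reflexivity. }
    apply le_INR. apply (run_count f T _ h eta PI l HT ET); auto; try lra.
    - intros x; apply derivable_continuous_pt.
      exists (RSF 1 t x). apply (RSF_deriv 0 t x ltac:(lia)).
    - unfold f; rewrite FP, Rabs_right; lra.
    - intros I HI. destruct (Hl' I HI) as (H1 & H2 & H3).
      split; [exact H3|split; [lia|]].
      assert (H4 : INR (2 * snd I + 218) <= INR n) by (apply le_INR; exact H2).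
      rewrite plus_INR, mult_INR in H4; simpl (INR 2) in H4.
      replace (INR 218) with 218 in H4 by (simpl; lra). nra. }
  exists (RS_sign t), (copies n l).
  split; [apply RS_sign_pm1|split; [|split]].
  - apply copies_well_separated; assumption.
  - intros theta Hout. rewrite cpoly_RSF. fold f.
    apply Rnot_lt_le; intros Hsmall.
    destruct (fold_angle theta) as (th0 & m & Hth0 & Hth).
    assert (Ef : f (2 * theta) = f (2 * th0)).
    { unfold f; destruct Hth as [->| ->].
      - rewrite <- (RSF_period t (2 * th0) m); f_equal; ring.
      - rewrite <- (RSF_even t (2 * th0)), <- (RSF_period t (- (2 * th0)) m); f_equal; ring. }
    rewrite Ef in Hsmall.
    destruct (nat_floor (2 * th0 / h)) as (k & K1 & K2); [apply Rle_mult_inv_pos; lra|].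
    assert (E : 2 * th0 / h * h = 2 * th0) by (field; lra).
    apply Rmult_le_compat_r with (r := h) in K1; [|lra].
    apply Rmult_lt_compat_r with (r := h) in K2; [|lra]. rewrite E in K1, K2.
    destruct (Hc k) as (I & HI & HIk).
    + assert (Hkn : INR (2 * k) <= INR n).
      { rewrite mult_INR; simpl (INR 2). apply Rmult_le_reg_r with h; lra. }
      apply INR_le in Hkn. pose proof (Nat.div_le_lower_bound n 2 k ltac:(lia) ltac:(lia)). lia.
    + exists (2 * th0); split; [lra|exact Hsmall].
    + destruct (arc_copies n l I theta th0 m Hn HI) as (J & HJ & HaJ); [|exact Hth|].
      * assert (Hw : PI / INR n = h / 2) by (unfold h; field; lra). rewrite Hw.
        assert (INR (fst I) <= INR k) by (apply le_INR; lia).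
        assert (INR (k + 1) <= INR (snd I)) by (apply le_INR; lia). nra.
      * exact (Hout J HJ HaJ).
  - intros theta. rewrite cpoly_RSF.
    eapply Rle_trans; [apply RSF_upper|].
    (* It remains to see that [(2 amp t)^2 = 8 * 2^t] is at most [gamma n], which is at least
       [2048 * 2^t], and that [gamma <= 1]. *)
    rewrite <- (sqrt_pow2 (2 * amp t)) by lra. apply sqrt_le_1_alt.
    rewrite Rpow_mult_distr, amp_sq. simpl (2 ^ S t).
    assert (g * INR n <= 1 * INR n) by (apply Rmult_le_compat_r; lra). simpl; lra.
Qed.
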